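(* Let $\lambda,\mu\in\mathbb{C}$ be such that $(\lambda,\mu)\in\Gamma_1$, i.e. $$\big((\lambda+1)i+t+2\mu\big)\big(i+\lambda(i+t)-2\mu\big)\neq 0\quad\text{for all } t\in\mathbb{N},\ i\in\mathbb{Z}_+.$$ Let $P$ be a simple restricted $\mathcal{G}_{\lambda,\mu}$-module, and assume that there exists $a\in\mathbb{Z}_+$ such that the action of $M_a$ on $P$ is injective. Then there exist $d_1,d_2\in\mathbb{N}$ with $d_1\ge 2d_2-1$ and a simple $\mathcal{G}_{\lambda,\mu}^{(d_1,d_2)}$-module $V$ such that for some $t\in\mathbb{N}$ (a) the action of $M_t$ on $V$ is injective; (b) $M_iV=Y_{j-\frac12}V=L_kV=0$ for all integers $i>t$, $j>t+d_2$ and $k>t+d_1$; (c) $\big((\lambda+1)i+t+2\mu\big)\big(i+d_1+\lambda(i+t+d_1)-2\mu\big)\neq 0$ for all $i\in\mathbb{Z}_+$; and such that $P\cong\mathrm{Ind}(V)$ as $\mathcal{G}_{\lambda,\mu}$-modules.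
   Context: $\mathbb{N}$ denotes the nonnegative integers and $\mathbb{Z}_+$ the positive integers. For $\lambda,\mu\in\mathbb{C}$, $\mathcal{G}_{\lambda,\mu}$ (the deformative Schrödinger–Virasoro algebra) is the complex Lie algebra with basis $\{L_m, M_m, Y_{m-\frac12}, C\mid m\in\mathbb{Z}\}$ and brackets, for $m,n\in\mathbb{Z}$, $$[L_m,L_n]=(n-m)L_{m+n}+\delta_{m+n,0}\tfrac{m^3-m}{12}C,\quad [L_m,Y_{n-\frac12}]=\Big(n-\tfrac{\lambda+1}{2}m+\mu-\tfrac12\Big)Y_{m+n-\frac12},$$ $$[Y_{m-\frac12},Y_{n-\frac12}]=(m-n)M_{m+n-1},\quad [L_m,M_n]=(n-\lambda m+2\mu)M_{m+n},$$ $$[M_m,M_n]=[M_m,Y_{n-\frac12}]=[\mathcal{G}_{\lambda,\mu},C]=0.$$ Throughout, $C$ is assumed to act on modules as a scalar $c\in\mathbb{C}$. For $d_1,d_2\in\mathbb{N}$ with $d_1\ge 2d_2-1$, $\mathcal{G}_{\lambda,\mu}^{(d_1,d_2)}$ is the subalgebra of $\mathcal{G}_{\lambda,\mu}$ spanned by $C$, all $M_{i-d_1}$ and $L_i$ with $i\in\mathbb{N}$, and all $Y_{i-d_2-\frac12}$ with $i\in\mathbb{Z}_+$. For a $\mathcal{G}_{\lambda,\mu}^{(d_1,d_2)}$-module $V$, the induced module is $\mathrm{Ind}(V)=\mathcal{U}(\mathcal{G}_{\lambda,\mu})\otimes_{\mathcal{U}(\mathcal{G}_{\lambda,\mu}^{(d_1,d_2)})}V$,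 where $\mathcal{U}$ denotes the universal enveloping algebra. The algebra is $\frac12\mathbb{Z}$-graded, $\mathcal{G}_{\lambda,\mu}=\bigoplus_{r\in\frac12\mathbb{Z}}\mathcal{G}_{\lambda,\mu}^{(r)}$, where $L_m,M_m$ have degree $m$, $Y_{m-\frac12}$ has degree $m-\frac12$, and $C$ has degree $0$. A $\mathcal{G}_{\lambda,\mu}$-module $P$ is restricted if for every $v\in P$ there exists $n\in\mathbb{N}$ such that $\mathcal{G}_{\lambda,\mu}^{(n+i)}v=0$ for all $i\in\frac12\mathbb{Z}_+$. *)

(* Defs.v *)
From HB Require Import structures.
From mathcomp Require Import all_boot all_order all_algebra.
From mathcomp Require Import finmap monalg.
From mathcomp Require Import boolp reals complex.
From mathcomp Require Import ring lra zify.

Set Implicit Arguments.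
Unset Strict Implicit.
Unset Printing Implicit Defensive.

Import Order.TTheory GRing.Theory Num.Theory.
Local Open Scope ring_scope.
Local Open Scope quotient_scope.

HB.mixin Record isLieAlgebra (K : fieldType) L of GRing.Lmodule K L := {
  lie : L -> L -> L;
  lie_linl : forall (a : K) x y z, lie (a *: x + y) z = a *: lie x z + lie y z;
  lie_linr : forall (a : K) x y z, lie z (a *: x + y) = a *: lie z x + lie z y;
  liexx : forall x, lie x x = 0;
  lie_jacobi : forall x y z,
    lie x (lie y z) + lie y (lie z x) + lie z (lie x y) = 0
}.

#[short(type="lieAlgType")]
HB.structure Definition LieAlgebra (K : fieldType) :=
  {L of isLieAlgebra K L & GRing.Lmodule K L}.

HB.mixin Record isLieModule (K : fieldType) (L : lieAlgType K) V
    of GRing.Lmodule K V := {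
  lact : L -> V -> V;
  lact_linl : forall (a : K) x y v,
    lact (a *: x + y) v = a *: lact x v + lact y v;
  lact_linr : forall (a : K) x v w,
    lact x (a *: v + w) = a *: lact x v + lact x w;
  lact_lie : forall x y v,
    lact (lie x y) v = lact x (lact y v) - lact y (lact x v)
}.

#[short(type="lieModType")]
HB.structure Definition LieModule (K : fieldType) (L : lieAlgType K) :=
  {V of isLieModule K L V & GRing.Lmodule K V}.

Section LieModuleNotions.
Variables (K : fieldType) (L : lieAlgType K).

Definition lie_submodule (V : lieModType L) (S : V -> Prop) : Prop :=
  [/\ S 0,
      forall (a : K) v w, S v -> S w -> S (a *: v + w)
    & forall (x : L) v, S v -> S (lact x v)].

Definition lie_simple (V : lieModType L) : Prop :=
  (exists v : V, v <> 0) /\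
  (forall S : V -> Prop, lie_submodule S ->
     (forall v, S v -> v = 0) \/ (forall v, S v)).

Definition lie_iso (V W : lieModType L) : Prop :=
  exists f : V -> W,
    [/\ bijective f,
        forall (a : K) v w, f (a *: v + w) = a *: f v + f w
      & forall (x : L) v, f (lact x v) = lact x (f v)].

End LieModuleNotions.

(* [lieSub L] is the type of Lie subalgebras S of L, and [lsub_type S] is S as a
   Lie algebra in its own right. *)
Record lieSub (K : fieldType) (L : lieAlgType K) := LieSub {
  lsub_pred :> {pred L};
  lsub_submod : submod_closed lsub_pred;
  lsub_lie : {in lsub_pred &, forall x y, lie x y \in lsub_pred}
}.

Record lsub_type (K : fieldType) (L : lieAlgType K) (S : lieSub L) :=
  LsubType { lsub_val : L; lsub_valP : lsub_val \in S }.

Section SubalgebraStructure.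
Variables (K : fieldType) (L : lieAlgType K) (S : lieSub L).

HB.instance Definition _ :=
  GRing.isSubmodClosed.Build K L (lsub_pred S) (lsub_submod S).
HB.instance Definition _ := [isSub for @lsub_val K L S].
HB.instance Definition _ := [Choice of lsub_type S by <:].
HB.instance Definition _ := [SubChoice_isSubLmodule of lsub_type S by <:].

Definition lsub_bracket (x y : lsub_type S) : lsub_type S :=
  LsubType (lsub_lie (lsub_valP x) (lsub_valP y)).

Lemma lsub_valD (x y : lsub_type S) : lsub_val (x + y) = lsub_val x + lsub_val y.
Proof. exact: (raddfD (val : lsub_type S -> L)). Qed.
Lemma lsub_valZ a (x : lsub_type S) : lsub_val (a *: x) = a *: lsub_val x.
Proof. exact: (@GRing.valZ _ _ _ (lsub_type S)). Qed.
Lemma lsub_val0 : lsub_val (0 : lsub_type S) = 0.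
Proof. exact: (raddf0 (val : lsub_type S -> L)). Qed.

Lemma lsub_inj : injective (@lsub_val K L S).
Proof. exact: val_inj. Qed.

Fact lsub_linl (a : K) x y z :
  lsub_bracket (a *: x + y) z = a *: lsub_bracket x z + lsub_bracket y z.
Proof.
by apply: lsub_inj; rewrite /= lie_linl.
Qed.
Fact lsub_linr (a : K) x y z :
  lsub_bracket z (a *: x + y) = a *: lsub_bracket z x + lsub_bracket z y.
Proof.
by apply: lsub_inj; rewrite /= lie_linr.
Qed.
Fact lsub_xx x : lsub_bracket x x = 0.
Proof. by apply: lsub_inj; rewrite /= liexx. Qed.
Fact lsub_jacobi x y z :
  lsub_bracket x (lsub_bracket y z) + lsub_bracket y (lsub_bracket z x) +
  lsub_bracket z (lsub_bracket x y) = 0.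
Proof. by apply: lsub_inj; rewrite /= lie_jacobi. Qed.

HB.instance Definition _ := isLieAlgebra.Build K (lsub_type S)
  lsub_linl lsub_linr lsub_xx lsub_jacobi.

End SubalgebraStructure.

(* The universal enveloping algebra of L: the associative unital K-algebra
   presented by one generator per element of L, subject to the linear
   relations of L and to xy - yx = [x, y]. It is realised as the quotient of
   the algebra expressions over L by the congruence [ueq]. *)
Inductive uterm (K : fieldType) (L : lieAlgType K) : Type :=
  | UVar of L
  | UScal of K
  | UAdd of uterm L & uterm L
  | UMul of uterm L & uterm L.
Arguments UScal {K L}.

Inductive ueq (K : fieldType) (L : lieAlgType K) :
    uterm L -> uterm L -> Prop :=
  | ueq_refl s : ueq s s
  | ueq_sym s t : ueq s t -> ueq t s
  | ueq_trans t s u : ueq s t -> ueq t u -> ueq s u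
  | ueq_add s s' t t' : ueq s s' -> ueq t t' -> ueq (UAdd s t) (UAdd s' t')
  | ueq_mul s s' t t' : ueq s s' -> ueq t t' -> ueq (UMul s t) (UMul s' t')
  | ueq_addA s t u : ueq (UAdd s (UAdd t u)) (UAdd (UAdd s t) u)
  | ueq_addC s t : ueq (UAdd s t) (UAdd t s)
  | ueq_add0 s : ueq (UAdd (UScal 0) s) s
  | ueq_addN s : ueq (UAdd (UMul (UScal (-1)) s) s) (UScal 0)
  | ueq_mulA s t u : ueq (UMul s (UMul t u)) (UMul (UMul s t) u)
  | ueq_mul1l s : ueq (UMul (UScal 1) s) s
  | ueq_mul1r s : ueq (UMul s (UScal 1)) s
  | ueq_mulDl s t u : ueq (UMul (UAdd s t) u) (UAdd (UMul s u) (UMul t u))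
  | ueq_mulDr s t u : ueq (UMul s (UAdd t u)) (UAdd (UMul s t) (UMul s u))
  | ueq_scalD a b : ueq (UScal (a + b)) (UAdd (UScal a) (UScal b))
  | ueq_scalM a b : ueq (UScal (a * b)) (UMul (UScal a) (UScal b))
  | ueq_scalC a s : ueq (UMul (UScal a) s) (UMul s (UScal a))
  | ueq_lin a x y :
      ueq (UVar (a *: x + y)) (UAdd (UMul (UScal a) (UVar x)) (UVar y))
  | ueq_lie x y :
      ueq (UVar (lie x y))
          (UAdd (UMul (UVar x) (UVar y))
                (UMul (UScal (-1)) (UMul (UVar y) (UVar x)))).

HB.instance Definition _ (K : fieldType) (L : lieAlgType K) :=
  gen_eqMixin (uterm L).
HB.instance Definition _ (K : fieldType) (L : lieAlgType K) :=
  gen_choiceMixin (uterm L).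

Section Enveloping.
Variables (K : fieldType) (L : lieAlgType K).

Definition ueqb (s t : uterm L) : bool := `[< ueq s t >].

Fact ueqb_refl : reflexive ueqb.
Proof. by move=> s; apply/asboolP/ueq_refl. Qed.
Fact ueqb_sym : symmetric ueqb.
Proof. by move=> s t; apply/asboolP/asboolP => /ueq_sym. Qed.
Fact ueqb_trans : transitive ueqb.
Proof.
by move=> t s u /asboolP st /asboolP tu; apply/asboolP/(ueq_trans st tu).
Qed.
Canonical ueq_equiv := EquivRel ueqb ueqb_refl ueqb_sym ueqb_trans.

Definition uenv : Type := {eq_quot ueq_equiv}.
HB.instance Definition _ := Choice.on uenv.

Definition upi (s : uterm L) : uenv := \pi_{eq_quot ueq_equiv} s.
Definition urepr (x : uenv) : uterm L := repr (x : {eq_quot ueq_equiv}).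

Lemma ureprK x : upi (urepr x) = x.
Proof. exact: (@reprK _ {eq_quot ueq_equiv}). Qed.

Lemma upiP s t : upi s = upi t <-> ueq s t.
Proof.
split=> [/eqmodP/asboolP //|st]; by apply/eqmodP/asboolP.
Qed.

Lemma urepr_pi s : ueq (urepr (upi s)) s.
Proof. by apply/upiP; rewrite ureprK. Qed.

Lemma uenv_ind (P : uenv -> Prop) : (forall s, P (upi s)) -> forall x, P x.
Proof. by move=> h x; rewrite -(ureprK x). Qed.

Definition uadd (x y : uenv) := upi (UAdd (urepr x) (urepr y)).
Definition umul (x y : uenv) := upi (UMul (urepr x) (urepr y)).
Definition uscal (a : K) : uenv := upi (UScal a).
Definition uiota (x : L) : uenv := upi (UVar x).

Lemma uaddE s t : uadd (upi s) (upi t) = upi (UAdd s t).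
Proof. by apply/upiP/ueq_add; apply: urepr_pi. Qed.
Lemma umulE s t : umul (upi s) (upi t) = upi (UMul s t).
Proof. by apply/upiP/ueq_mul; apply: urepr_pi. Qed.

Fact uaddA : associative uadd.
Proof.
elim/uenv_ind=> s; elim/uenv_ind=> t; elim/uenv_ind=> u.
by rewrite !uaddE; apply/upiP/ueq_addA.
Qed.
Fact uaddC : commutative uadd.
Proof.
by elim/uenv_ind=> s; elim/uenv_ind=> t; rewrite !uaddE; apply/upiP/ueq_addC.
Qed.
Fact uadd0 : left_id (uscal 0) uadd.
Proof. by elim/uenv_ind=> s; rewrite uaddE; apply/upiP/ueq_add0. Qed.
Fact uaddN : left_inverse (uscal 0) (umul (uscal (-1))) uadd.
Proof. by elim/uenv_ind=> s; rewrite umulE uaddE; apply/upiP/ueq_addN. Qed.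

HB.instance Definition _ := GRing.isZmodule.Build uenv uaddA uaddC uadd0 uaddN.

Fact umulA : associative umul.
Proof.
elim/uenv_ind=> s; elim/uenv_ind=> t; elim/uenv_ind=> u.
by rewrite !umulE; apply/upiP/ueq_mulA.
Qed.
Fact umul1l : left_id (uscal 1) umul.
Proof. by elim/uenv_ind=> s; rewrite umulE; apply/upiP/ueq_mul1l. Qed.
Fact umul1r : right_id (uscal 1) umul.
Proof. by elim/uenv_ind=> s; rewrite umulE; apply/upiP/ueq_mul1r. Qed.
Fact umulDl : left_distributive umul uadd.
Proof.
elim/uenv_ind=> s; elim/uenv_ind=> t; elim/uenv_ind=> u.
by rewrite !(umulE, uaddE); apply/upiP/ueq_mulDl.
Qed.
Fact umulDr : right_distributive umul uadd.
Proof.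
elim/uenv_ind=> s; elim/uenv_ind=> t; elim/uenv_ind=> u.
by rewrite !(umulE, uaddE); apply/upiP/ueq_mulDr.
Qed.

(* The augmentation, used to see that 1 <> 0. *)
Fixpoint ueps (s : uterm L) : K :=
  match s with
  | UVar _ => 0
  | UScal a => a
  | UAdd s t => ueps s + ueps t
  | UMul s t => ueps s * ueps t
  end.
Lemma ueps_eq s t : ueq s t -> ueps s = ueps t.
Proof. by elim=> //= *; try congruence; ring. Qed.
Fact uone_neq0 : uscal 1 != uscal 0.
Proof. by apply/eqP=> /upiP /ueps_eq /eqP; rewrite /= oner_eq0. Qed.

HB.instance Definition _ := GRing.Zmodule_isNzRing.Build uenv
  umulA umul1l umul1r umulDl umulDr uone_neq0.

Definition uscale (a : K) (x : uenv) : uenv := uscal a * x.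
Lemma uscalD a b : uscal (a + b) = uscal a + uscal b.
Proof. by rewrite [RHS]uaddE; apply/upiP/ueq_scalD. Qed.
Lemma uscalM a b : uscal (a * b) = uscal a * uscal b.
Proof. by rewrite [RHS]umulE; apply/upiP/ueq_scalM. Qed.
Lemma uscalC a x : uscal a * x = x * uscal a.
Proof. by elim/uenv_ind: x => s; rewrite [LHS]umulE [RHS]umulE; apply/upiP/ueq_scalC. Qed.

Fact uscaleA a b x : uscale a (uscale b x) = uscale (a * b) x.
Proof. by rewrite /uscale mulrA uscalM. Qed.
Fact uscale1 : left_id 1 uscale.
Proof. by move=> x; exact: mul1r. Qed.
Fact uscaleDr : right_distributive uscale +%R.
Proof. by move=> a x y; exact: mulrDr. Qed.
Fact uscaleDl x : {morph uscale^~ x : a b / a + b}.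
Proof. by move=> a b; rewrite /uscale uscalD mulrDl. Qed.
HB.instance Definition _ := GRing.Zmodule_isLmodule.Build K uenv
  uscaleA uscale1 uscaleDr uscaleDl.
Fact uscaleAl a (x y : uenv) : a *: (x * y) = (a *: x) * y.
Proof. exact: mulrA. Qed.
HB.instance Definition _ := GRing.Lmodule_isLalgebra.Build K uenv uscaleAl.
Fact uscaleAr a (x y : uenv) : a *: (x * y) = x * (a *: y).
Proof.
rewrite -[LHS]/(uscal a * (x * y)) -[a *: y]/(uscal a * y).
by rewrite mulrA uscalC -mulrA.
Qed.
HB.instance Definition _ := GRing.Lalgebra_isAlgebra.Build K uenv uscaleAr.

Lemma uiota_lin a x y : uiota (a *: x + y) = a *: uiota x + uiota y.
Proof. 
rewrite -[RHS]/(uadd (umul (uscal a) (uiota x)) (uiota y)) umulE uaddE.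
exact/upiP/ueq_lin.
 Qed.

Lemma uscalN1 x : uscal (-1) * x = - x.
Proof. by []. Qed.

Lemma uiota_lie x y :
  uiota (lie x y) = uiota x * uiota y - uiota y * uiota x.
Proof.
rewrite -[RHS]/(uadd (umul (uiota x) (uiota y))
  (umul (uscal (-1)) (umul (uiota y) (uiota x)))).
rewrite (umulE (UVar y) (UVar x)) (umulE (UVar x) (UVar y)) umulE uaddE.
exact/upiP/ueq_lie.
Qed.

End Enveloping.

(* An L-module is the same thing as a left U(L)-module; [umod V] is the
   abelian group V with that structure. *)
Definition umod (K : fieldType) (L : lieAlgType K) (V : lieModType L) : Type := V.

Section ModuleOverEnveloping.
Variables (K : fieldType) (L : lieAlgType K) (V : lieModType L).

HB.instance Definition _ := GRing.Zmodule.copy (umod V) V.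

Fixpoint ueval (s : uterm L) (v : V) : V :=
  match s with
  | UVar x => lact x v
  | UScal a => a *: v
  | UAdd s t => ueval s v + ueval t v
  | UMul s t => ueval s (ueval t v)
  end.

Lemma ueval_lin s a v w : ueval s (a *: v + w) = a *: ueval s v + ueval s w.
Proof.
elim: s v w => [x|b|s IHs t IHt|s IHs t IHt] v w /=.
- exact: lact_linr.
- by rewrite scalerDr !scalerA mulrC.
- by rewrite IHs IHt scalerDr addrACA.
- by rewrite IHt IHs.
Qed.

Lemma ueval0 s : ueval s 0 = 0.
Proof. by have := ueval_lin s (-1) 0 0; rewrite scaler0 addr0 scaleN1r addNr. Qed.
Lemma uevalD s v w : ueval s (v + w) = ueval s v + ueval s w.
Proof. by have := ueval_lin s 1 v w; rewrite !scale1r. Qed.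
Lemma uevalZ s a v : ueval s (a *: v) = a *: ueval s v.
Proof. by have := ueval_lin s a v 0; rewrite ueval0 !addr0. Qed.

Lemma ueval_eq s t : ueq s t -> forall v, ueval s v = ueval t v.
Proof.
elim=> //= {s t}.
- by move=> t s u _ IH1 _ IH2 v; rewrite IH1.
- by move=> s s' t t' _ IH1 _ IH2 v; rewrite IH1 IH2.
- by move=> s s' t t' _ IH1 _ IH2 v; rewrite IH2 IH1.
- by move=> *; rewrite addrA.
- by move=> *; rewrite addrC.
- by move=> *; rewrite scale0r add0r.
- by move=> *; rewrite scaleN1r addNr scale0r.
- by move=> *; rewrite scale1r.
- by move=> *; rewrite scale1r.
- by move=> *; rewrite uevalD.
- by move=> *; rewrite scalerDl.
- by move=> *; rewrite scalerA.
- by move=> *; rewrite uevalZ.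
- by move=> *; rewrite lact_linl.
- by move=> *; rewrite lact_lie scaleN1r.
Qed.

Definition uact (x : uenv L) (v : umod V) : umod V := ueval (urepr x) v.

Lemma uactE s v : uact (upi s) v = ueval s v.
Proof. exact/ueval_eq/urepr_pi. Qed.

Fact uactA x y v : uact x (uact y v) = uact (x * y) v.
Proof.
elim/uenv_ind: x => s; elim/uenv_ind: y => t.
by rewrite [_ * _]umulE !uactE.
Qed.
Fact uact1 : left_id 1 uact.
Proof. by move=> v; rewrite [LHS]uactE /= scale1r. Qed.
Fact uactDr : right_distributive uact +%R.
Proof. by elim/uenv_ind=> s v w; rewrite !uactE; apply: uevalD. Qed.
Fact uactDl v : {morph uact^~ v : x y / x + y}.
Proof.
elim/uenv_ind=> s; elim/uenv_ind=> t.
by rewrite [_ + _]uaddE !uactE.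
Qed.
HB.instance Definition _ := GRing.Zmodule_isLmodule.Build (uenv L) (umod V)
  uactA uact1 uactDr uactDl.

End ModuleOverEnveloping.

(* The ring morphism U(S) -> U(L) induced by the inclusion of S in L. *)
Section EnvelopingInclusion.
Variables (K : fieldType) (L : lieAlgType K) (S : lieSub L).

Fixpoint uterm_incl (s : uterm (lsub_type S)) : uterm L :=
  match s with
  | UVar x => UVar (lsub_val x)
  | UScal a => UScal a
  | UAdd s t => UAdd (uterm_incl s) (uterm_incl t)
  | UMul s t => UMul (uterm_incl s) (uterm_incl t)
  end.

Lemma uterm_incl_eq s t : ueq s t -> ueq (uterm_incl s) (uterm_incl t).
Proof.
elim=> //= {s t}; try by constructor.
by move=> t s u _ IH1 _ IH2; apply: ueq_trans IH1 IH2.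
Qed.

Definition uincl (x : uenv (lsub_type S)) : uenv L := upi (uterm_incl (urepr x)).

Lemma uinclE s : uincl (upi s) = upi (uterm_incl s).
Proof. exact/upiP/uterm_incl_eq/urepr_pi. Qed.

Fact uincl_zmod : zmod_morphism uincl.
Proof.
elim/uenv_ind=> s; elim/uenv_ind=> t.
by rewrite -uscalN1 -[- uincl _]uscalN1 [uscal _ _ * _]umulE [_ + _]uaddE !uinclE
           [uscal _ _ * _]umulE [RHS]uaddE.
Qed.
Fact uincl_monoid : monoid_morphism uincl.
Proof.
split; first exact: uinclE.
elim/uenv_ind=> s; elim/uenv_ind=> t.
by rewrite [_ * _]umulE !uinclE [RHS]umulE.
Qed.
HB.instance Definition _ :=
  GRing.isZmodMorphism.Build (uenv (lsub_type S)) (uenv L) uincl uincl_zmod.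
HB.instance Definition _ :=
  GRing.isMonoidMorphism.Build (uenv (lsub_type S)) (uenv L) uincl uincl_monoid.

End EnvelopingInclusion.

(* Extension of scalars: for a ring morphism f : B -> A and a left B-module V,
   the left A-module A (x)_B V, where A is a right B-module through f. It is
   the abelian group generated by the symbols a (x) v, subject to biadditivity
   and to a f(b) (x) v = a (x) bv. *)
Inductive tterm (A V : Type) : Type :=
  | TZero
  | TTens of A & V
  | TAdd of tterm A V & tterm A V
  | TOpp of tterm A V.
Arguments TZero {A V}.

Inductive teq (B A : pzRingType) (f : {rmorphism B -> A}) (V : lmodType B) :
    tterm A V -> tterm A V -> Prop :=
  | teq_refl s : teq f s s
  | teq_sym s t : teq f s t -> teq f t s
  | teq_trans t s u : teq f s t -> teq f t u -> teq f s u
  | teq_add s s' t t' :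
      teq f s s' -> teq f t t' -> teq f (TAdd s t) (TAdd s' t')
  | teq_opp s s' : teq f s s' -> teq f (TOpp s) (TOpp s')
  | teq_addA s t u : teq f (TAdd s (TAdd t u)) (TAdd (TAdd s t) u)
  | teq_addC s t : teq f (TAdd s t) (TAdd t s)
  | teq_add0 s : teq f (TAdd TZero s) s
  | teq_addN s : teq f (TAdd (TOpp s) s) TZero
  | teq_tensDl a a' v :
      teq f (TTens (a + a') v) (TAdd (TTens a v) (TTens a' v))
  | teq_tensDr a v v' :
      teq f (TTens a (v + v')) (TAdd (TTens a v) (TTens a v'))
  | teq_bal a b v : teq f (TTens (a * f b) v) (TTens a (b *: v)).

HB.instance Definition _ (A V : Type) := gen_eqMixin (tterm A V).
HB.instance Definition _ (A V : Type) := gen_choiceMixin (tterm A V).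

Section ExtensionOfScalars.
Variables (B A : pzRingType) (f : {rmorphism B -> A}) (V : lmodType B).

Definition teqb (s t : tterm A V) : bool := `[< teq f s t >].

Fact teqb_refl : reflexive teqb.
Proof. by move=> s; apply/asboolP/teq_refl. Qed.
Fact teqb_sym : symmetric teqb.
Proof. by move=> s t; apply/asboolP/asboolP => /teq_sym. Qed.
Fact teqb_trans : transitive teqb.
Proof.
by move=> t s u /asboolP st /asboolP tu; apply/asboolP/(teq_trans st tu).
Qed.
Canonical teq_equiv := EquivRel teqb teqb_refl teqb_sym teqb_trans.

Definition extscal : Type := {eq_quot teq_equiv}.
HB.instance Definition _ := Choice.on extscal.

Definition tpi (s : tterm A V) : extscal := \pi_{eq_quot teq_equiv} s.
Definition trepr (x : extscal) : tterm A V := repr (x : {eq_quot teq_equiv}).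

Lemma treprK x : tpi (trepr x) = x.
Proof. exact: (@reprK _ {eq_quot teq_equiv}). Qed.
Lemma tpiP s t : tpi s = tpi t <-> teq f s t.
Proof.
split=> [/eqmodP/asboolP //|st]; by apply/eqmodP/asboolP.
Qed.
Lemma trepr_pi s : teq f (trepr (tpi s)) s.
Proof. by apply/tpiP; rewrite treprK. Qed.
Lemma extscal_ind (P : extscal -> Prop) :
  (forall s, P (tpi s)) -> forall x, P x.
Proof. by move=> h x; rewrite -(treprK x). Qed.

Definition tadd (x y : extscal) := tpi (TAdd (trepr x) (trepr y)).
Definition topp (x : extscal) := tpi (TOpp (trepr x)).
Definition tens (a : A) (v : V) : extscal := tpi (TTens a v).

Lemma taddE s t : tadd (tpi s) (tpi t) = tpi (TAdd s t).
Proof. by apply/tpiP/teq_add; apply: trepr_pi. Qed.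
Lemma toppE s : topp (tpi s) = tpi (TOpp s).
Proof. by apply/tpiP/teq_opp; apply: trepr_pi. Qed.

Fact taddA : associative tadd.
Proof.
elim/extscal_ind=> s; elim/extscal_ind=> t; elim/extscal_ind=> u.
by rewrite !taddE; apply/tpiP/teq_addA.
Qed.
Fact taddC : commutative tadd.
Proof.
by elim/extscal_ind=> s; elim/extscal_ind=> t; rewrite !taddE; apply/tpiP/teq_addC.
Qed.
Fact tadd0 : left_id (tpi TZero) tadd.
Proof. by elim/extscal_ind=> s; rewrite taddE; apply/tpiP/teq_add0. Qed.
Fact taddN : left_inverse (tpi TZero) topp tadd.
Proof. by elim/extscal_ind=> s; rewrite toppE taddE; apply/tpiP/teq_addN. Qed.
HB.instance Definition _ := GRing.isZmodule.Build extscal taddA taddC tadd0 taddN.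

Lemma tensDl a a' v : tens (a + a') v = tens a v + tens a' v.
Proof. by rewrite [RHS]taddE; apply/tpiP/teq_tensDl. Qed.
Lemma tensDr a v v' : tens a (v + v') = tens a v + tens a v'.
Proof. by rewrite [RHS]taddE; apply/tpiP/teq_tensDr. Qed.
Lemma tens_bal a b v : tens (a * f b) v = tens a (b *: v).
Proof. by apply/tpiP/teq_bal. Qed.

Fixpoint tterm_scale (a : A) (s : tterm A V) : tterm A V :=
  match s with
  | TZero => TZero
  | TTens a' v => TTens (a * a') v
  | TAdd s t => TAdd (tterm_scale a s) (tterm_scale a t)
  | TOpp s => TOpp (tterm_scale a s)
  end.

Lemma tterm_scale_eq a s t :
  teq f s t -> teq f (tterm_scale a s) (tterm_scale a t).
Proof.
elim=> //= {s t}; try by constructor.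
- by move=> t s u _ IH1 _ IH2; apply: teq_trans IH1 IH2.
- by move=> a1 a2 v; rewrite mulrDr; constructor.
- by move=> a1 b v; rewrite mulrA; constructor.
Qed.

Definition tscale (a : A) (x : extscal) : extscal :=
  tpi (tterm_scale a (trepr x)).

Lemma tscaleE a s : tscale a (tpi s) = tpi (tterm_scale a s).
Proof. exact/tpiP/tterm_scale_eq/trepr_pi. Qed.

Lemma tpiD s t : tpi (TAdd s t) = tpi s + tpi t.
Proof. by rewrite -taddE. Qed.
Lemma tpiN s : tpi (TOpp s) = - tpi s.
Proof. by rewrite -toppE. Qed.
Lemma tpi0 : tpi TZero = 0.
Proof. by []. Qed.

Fact tscaleA a b x : tscale a (tscale b x) = tscale (a * b) x.
Proof.
elim/extscal_ind: x; elim=> [|c v|s IHs t IHt|s IHs]; rewrite !tscaleE //=.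
- by rewrite mulrA.
- by rewrite !tpiD -!tscaleE -IHs -IHt !tscaleE.
- by rewrite !tpiN -!tscaleE -IHs !tscaleE.
Qed.
Fact tscale1 : left_id 1 tscale.
Proof.
elim/extscal_ind; elim=> [|c v|s IHs t IHt|s IHs]; rewrite !tscaleE //=.
- by rewrite mul1r.
- by rewrite !tpiD -!tscaleE IHs IHt.
- by rewrite !tpiN -!tscaleE IHs.
Qed.
Fact tscaleDr : right_distributive tscale +%R.
Proof.
move=> a; elim/extscal_ind=> s; elim/extscal_ind=> t.
by rewrite -tpiD !tscaleE /= tpiD.
Qed.
Fact tscaleDl x : {morph tscale^~ x : a b / a + b}.
Proof.
move=> a b; elim/extscal_ind: x; elim=> [|c v|s IHs t IHt|s IHs];
  rewrite !tscaleE /=.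
- by rewrite tpi0 addr0.
- by rewrite mulrDl; exact: tensDl.
- by rewrite !tpiD -!tscaleE IHs IHt addrACA.
- by rewrite !tpiN -!tscaleE IHs opprD.
Qed.
HB.instance Definition _ := GRing.Zmodule_isLmodule.Build A extscal
  tscaleA tscale1 tscaleDr tscaleDl.

Lemma scale_tens a b v : a *: tens b v = tens (a * b) v.
Proof. exact: tscaleE. Qed.

End ExtensionOfScalars.

(* Ind V = U(L) (x)_{U(S)} V, with K and L acting through U(L). *)
Definition Ind (K : fieldType) (L : lieAlgType K) (S : lieSub L)
    (V : lieModType (lsub_type S)) : Type :=
  extscal (@uincl K L S) (umod V).

Section InducedModule.
Variables (K : fieldType) (L : lieAlgType K) (S : lieSub L).
Variable V : lieModType (lsub_type S).

Local Notation tensor := (extscal (@uincl K L S) (umod V)).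

HB.instance Definition _ := GRing.Zmodule.copy (Ind V) tensor.

Definition ind_scale (a : K) (w : Ind V) : Ind V :=
  ((a *: 1 : uenv L) *: (w : tensor)).
Definition ind_act (x : L) (w : Ind V) : Ind V :=
  (uiota x *: (w : tensor)).

Fact ind_scaleA a b w : ind_scale a (ind_scale b w) = ind_scale (a * b) w.
Proof. by rewrite /ind_scale scalerA -scalerAl mul1r scalerA. Qed.
Fact ind_scale1 : left_id 1 ind_scale.
Proof. by move=> w; rewrite /ind_scale !scale1r. Qed.
Fact ind_scaleDr : right_distributive ind_scale +%R.
Proof. by move=> a v w; exact: scalerDr. Qed.
Fact ind_scaleDl w : {morph ind_scale^~ w : a b / a + b}.
Proof. by move=> a b; rewrite /ind_scale !scalerDl. Qed.
HB.instance Definition _ := GRing.Zmodule_isLmodule.Build K (Ind V)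
  ind_scaleA ind_scale1 ind_scaleDr ind_scaleDl.

Fact ind_linl (a : K) x y w :
  ind_act (a *: x + y) w = a *: ind_act x w + ind_act y w.
Proof.
rewrite /ind_act uiota_lin scalerDl; congr (_ + _).
by rewrite [RHS]scalerA -scalerAl mul1r.
Qed.
Fact ind_linr (a : K) x v w :
  ind_act x (a *: v + w) = a *: ind_act x v + ind_act x w.
Proof.
rewrite /ind_act [LHS]scalerDr; congr (_ + _).
by rewrite [LHS]scalerA [RHS]scalerA -scalerAl -scalerAr mulr1 mul1r.
Qed.
Fact ind_lie x y w :
  ind_act (lie x y) w = ind_act x (ind_act y w) - ind_act y (ind_act x w).
Proof. by rewrite /ind_act uiota_lie [LHS]scalerBl -!scalerA. Qed.
HB.instance Definition _ := isLieModule.Build K L (Ind V)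
  ind_linl ind_linr ind_lie.

End InducedModule.

(* The index set of the basis L_m, M_m, Y_{m - 1/2}, C; [gY m] stands for
   Y_{m - 1/2}, not Y_m. *)
Variant gen : Type := gL of int | gM of int | gY of int | gC.

Definition gen_encode (g : gen) : int + (int + (int + unit)) :=
  match g with
  | gL m => inl m
  | gM m => inr (inl m)
  | gY m => inr (inr (inl m))
  | gC => inr (inr (inr tt))
  end.
Definition gen_decode (c : int + (int + (int + unit))) : gen :=
  match c with
  | inl m => gL m
  | inr (inl m) => gM m
  | inr (inr (inl m)) => gY m
  | inr (inr (inr _)) => gC
  end.
Lemma gen_encodeK : cancel gen_encode gen_decode.
Proof. by case. Qed.
HB.instance Definition _ := Choice.copy gen (can_type gen_encodeK).


Section JacobiOnBasis.
Variables (K : numFieldType) (lam mu : K) (W : lmodType K).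
Variables (br : W -> W -> W) (e : gen -> W).
Local Notation eL m := (e (gL m)).
Local Notation eM m := (e (gM m)).
Local Notation eY m := (e (gY m)).
Local Notation eC := (e gC).
Hypothesis br_lin : forall (a : K) x y z, br z (a *: x + y) = a *: br z x + br z y.
Hypothesis brLL : forall m n, br (eL m) (eL n) = (n - m)%:~R *: eL (m + n) +
  (if m + n == 0 then (m ^+ 3 - m)%:~R / 12 else 0) *: eC.
Hypothesis brLY : forall m n, br (eL m) (eY n) =
  (n%:~R - (lam + 1) / 2 * m%:~R + mu - 1 / 2) *: eY (m + n).
Hypothesis brYL : forall m n, br (eY n) (eL m) =
  - ((n%:~R - (lam + 1) / 2 * m%:~R + mu - 1 / 2) *: eY (m + n)).
Hypothesis brYY : forall m n,
  br (eY m) (eY n) = (m - n)%:~R *: eM (m + n - 1).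
Hypothesis brLM : forall m n, br (eL m) (eM n) =
  (n%:~R - lam * m%:~R + 2 * mu) *: eM (m + n).
Hypothesis brML : forall m n, br (eM n) (eL m) =
  - ((n%:~R - lam * m%:~R + 2 * mu) *: eM (m + n)).
Hypothesis brMM : forall m n, br (eM m) (eM n) = 0.
Hypothesis brMY : forall m n, br (eM m) (eY n) = 0.
Hypothesis brYM : forall m n, br (eY m) (eM n) = 0.
Hypothesis brC : forall g, br (e g) eC = 0.
Hypothesis Cbr : forall g, br eC (e g) = 0.

Let br0 z : br z 0 = 0.
Proof. by have := br_lin (-1) 0 0 z; rewrite scaler0 addr0 scaleN1r addNr. Qed.
Let brZ a z x : br z (a *: x) = a *: br z x.
Proof. by have := br_lin a x 0 z; rewrite br0 !addr0. Qed.
Let brD z x y : br z (x + y) = br z x + br z y.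
Proof. by have := br_lin 1 x y z; rewrite !scale1r. Qed.
Let brN z x : br z (- x) = - br z x.
Proof. by rewrite -scaleN1r brZ scaleN1r. Qed.
Let jac x y z := br x (br y z) + br y (br z x) + br z (br x y).

Lemma jac_LLL m n k : jac (eL m) (eL n) (eL k) = 0.
Proof.
rewrite /jac !(brLL, brD, brZ, brC) !scaler0 !addr0 !scalerDr !scalerA.
have -> : n + (k + m) = m + (n + k) by ring.
have -> : k + (m + n) = m + (n + k) by ring.
rewrite (addrACA (_ *: eL _) (_ *: eC)) (addrACA (_ *: eL _ + _ *: eL _)).
rewrite -!scalerDl [X in X *: eL _](_ : _ = 0); last first.
  by rewrite !intrD; ring.
rewrite scale0r add0r; case: eqP => [E|_]; last by rewrite !mulr0 !addr0 scale0r.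
have -> : k = - m - n by lia.
rewrite [X in X *: _](_ : _ = 0) ?scale0r //.
by rewrite !rmorphB !rmorphXn /= !(rmorphD, rmorphN) /=; field.
Qed.

Lemma jac_LLM m n k : jac (eL m) (eL n) (eM k) = 0.
Proof.
rewrite /jac !(brLL, brLM, brML, brD, brN, brZ, brC) scaler0 addr0 scalerN.
have -> : n + (m + k) = m + (n + k) by ring.
have -> : m + n + k = m + (n + k) by ring.
rewrite !scalerA -!scaleNr -!scalerDl.
by rewrite [X in X *: _](_ : _ = 0) ?scale0r // !(intrD, intrB); ring.
Qed.

Lemma jac_LLY m n k : jac (eL m) (eL n) (eY k) = 0.
Proof.
rewrite /jac !(brLL, brLY, brYL, brD, brN, brZ, brC) scaler0 addr0 scalerN.
have -> : n + (m + k) = m + (n + k) by ring.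
have -> : m + n + k = m + (n + k) by ring.
rewrite !scalerA -!scaleNr -!scalerDl.
by rewrite [X in X *: _](_ : _ = 0) ?scale0r // !(intrD, intrB); field.
Qed.

Lemma jac_LYY m n k : jac (eL m) (eY n) (eY k) = 0.
Proof.
rewrite /jac !(brLY, brYL, brYY, brLM, brD, brN, brZ).
have -> : n + (m + k) - 1 = m + (n + k - 1) by ring.
have -> : k + (m + n) - 1 = m + (n + k - 1) by ring.
rewrite !scalerA -!scaleNr -!scalerDl.
by rewrite [X in X *: _](_ : _ = 0) ?scale0r // !(intrD, intrB); field.
Qed.

Lemma jac_rot x y z : jac x y z = jac y z x.
Proof. by rewrite /jac -addrA addrC. Qed.

Lemma jac_basis g h k :
  br (e g) (br (e h) (e k)) + br (e h) (br (e k) (e g)) +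
  br (e k) (br (e g) (e h)) = 0.
Proof.
rewrite -/(jac (e g) (e h) (e k)).
case: g h k => [m|m|m|] [n|n|n|] [k|k|k|];
  solve [ exact: jac_LLL | exact: jac_LLM | exact: jac_LLY | exact: jac_LYY
  | rewrite jac_rot; solve [exact: jac_LLM | exact: jac_LLY | exact: jac_LYY]
  | rewrite -jac_rot; solve [exact: jac_LLM | exact: jac_LLY | exact: jac_LYY]
  | by rewrite /jac !(brLL, brLY, brYL, brYY, brLM, brML, brMM, brMY, brYM, brC,
      Cbr, brD, brN, brZ, br0, scaler0, oppr0, addr0) ].
Qed.

Hypothesis br_linl : forall (a : K) x y z,
  br (a *: x + y) z = a *: br x z + br y z.
Hypothesis e_ind : forall P : W -> Prop,
  P 0 -> (forall a g y, P y -> P (a *: e g + y)) -> forall x, P x.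

Let jac_lin a x x' y z : jac (a *: x + x') y z = a *: jac x y z + jac x' y z.
Proof.
rewrite /jac !(br_linl, br_lin) !scalerDr.
rewrite (addrACA (a *: br x _) _ (a *: br y _)).
by rewrite (addrACA (a *: br x _ + a *: br y _) _ (a *: br z _)).
Qed.

Lemma jacobi_of_basis x y z :
  br x (br y z) + br y (br z x) + br z (br x y) = 0.
Proof.
have j0 v w : jac 0 v w = 0.
  by have := jac_lin (-1) 0 0 v w; rewrite scaler0 addr0 scaleN1r addNr.
rewrite -/(jac x y z).
elim/e_ind: x => [|a g x IHx]; first exact: j0.
rewrite jac_lin IHx addr0 jac_rot {x IHx}.
elim/e_ind: y => [|b h y IHy]; first by rewrite j0 scaler0.
rewrite jac_lin scalerDr IHy addr0 jac_rot {y IHy}.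
elim/e_ind: z => [|c k z IHz]; first by rewrite j0 !scaler0.
by rewrite jac_lin (scalerDr b) (scalerDr a) IHz addr0 /jac jac_basis !scaler0.
Qed.
End JacobiOnBasis.

Definition DSV (K : numFieldType) (lam mu : K) : Type := {malg K[gen]}.

Section DSVAlgebra.
Variables (K : numFieldType) (lam mu : K).

HB.instance Definition _ := GRing.Lmodule.copy (DSV lam mu) {malg K[gen]}.

Definition dsv (g : gen) : DSV lam mu := << g >>.

Definition dsv_brk (g h : gen) : DSV lam mu :=
  match g, h with
  | gL m, gL n =>
      (n - m)%:~R *: dsv (gL (m + n)) +
      (if m + n == 0 then (m ^+ 3 - m)%:~R / 12 else 0) *: dsv gC
  | gL m, gY n =>
      (n%:~R - (lam + 1) / 2 * m%:~R + mu - 1 / 2) *: dsv (gY (m + n))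
  | gY n, gL m =>
      - ((n%:~R - (lam + 1) / 2 * m%:~R + mu - 1 / 2) *: dsv (gY (m + n)))
  | gY m, gY n => (m - n)%:~R *: dsv (gM (m + n - 1))
  | gL m, gM n => (n%:~R - lam * m%:~R + 2 * mu) *: dsv (gM (m + n))
  | gM n, gL m => - ((n%:~R - lam * m%:~R + 2 * mu) *: dsv (gM (m + n)))
  | _, _ => 0
  end.

(* Linear extension of a function on the basis. *)
Definition dsv_ext (W : lmodType K) (f : gen -> W) (x : DSV lam mu) : W :=
  \sum_(g <- msupp (x : {malg K[gen]})) (x : {malg K[gen]})@_g *: f g.

Definition dsv_lie (x y : DSV lam mu) : DSV lam mu :=
  dsv_ext (fun g => dsv_ext (fun h => dsv_brk g h) y) x.

Lemma dsv_ext_sub (W : lmodType K) (f : gen -> W) (x : {malg K[gen]})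
    (D : {fset gen}) : (msupp x `<=` D)%fset ->
  dsv_ext f x = \sum_(g <- D) x@_g *: f g.
Proof.
move=> sD; rewrite /dsv_ext (big_fset_incl _ sD) // => g _ gx.
by rewrite (mcoeff_outdom gx) scale0r.
Qed.

Lemma dsv_ext_lin (W : lmodType K) (f : gen -> W) (a : K) (x y : DSV lam mu) :
  dsv_ext f (a *: x + y) = a *: dsv_ext f x + dsv_ext f y.
Proof.
pose D := (msupp (x : {malg K[gen]}) `|` msupp (y : {malg K[gen]}))%fset.
have sx : (msupp (x : {malg K[gen]}) `<=` D)%fset by apply: fsubsetUl.
have sy : (msupp (y : {malg K[gen]}) `<=` D)%fset by apply: fsubsetUr.
rewrite (dsv_ext_sub _ sx) (dsv_ext_sub _ sy) (@dsv_ext_sub _ _ _ D); last first.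
  apply: fsubset_trans (msuppD_le _ _) _; apply: fsetSU; exact: msuppZ_le.
rewrite scaler_sumr -big_split /=; apply: eq_bigr => g _.
by rewrite mcoeffD mcoeffZ scalerDl scalerA.
Qed.

Lemma dsv_ext_basis (W : lmodType K) (f : gen -> W) (g : gen) :
  dsv_ext f (dsv g) = f g.
Proof.
rewrite (@dsv_ext_sub _ _ _ [fset g]%fset) ?msuppU_le //.
by rewrite big_seq_fset1 mcoeffUU scale1r.
Qed.

Lemma dsv_ind (P : DSV lam mu -> Prop) :
  P 0 -> (forall (a : K) g y, P y -> P (a *: dsv g + y)) -> forall x, P x.
Proof.
move=> P0 PS x; have -> : x = \sum_(g <- msupp (x : {malg K[gen]}))
    (x : {malg K[gen]})@_g *: dsv g.
  rewrite [LHS](@monalgE gen K (x : {malg K[gen]})).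
  apply: eq_bigr => g _; apply/malgP => h.
  by rewrite mcoeffZ /dsv !mcoeffU mulr_natr.
elim: (enum_fset _) => [|g s IH]; first by rewrite big_nil.
by rewrite big_cons; apply: PS.
Qed.

Fact dsv_linl (a : K) x y z :
  dsv_lie (a *: x + y) z = a *: dsv_lie x z + dsv_lie y z.
Proof. exact: dsv_ext_lin. Qed.

Fact dsv_linr (a : K) x y z :
  dsv_lie z (a *: x + y) = a *: dsv_lie z x + dsv_lie z y.
Proof.
rewrite /dsv_lie /dsv_ext scaler_sumr -big_split /=; apply: eq_bigr => g _.
rewrite -!/(dsv_ext _ _) dsv_ext_lin scalerDr !scalerA; congr (_ *: _ + _).
exact: mulrC.
Qed.

Lemma dsv_lieE g h : dsv_lie (dsv g) (dsv h) = dsv_brk g h.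
Proof. by rewrite /dsv_lie !dsv_ext_basis. Qed.

Lemma dsv_lie0l x : dsv_lie 0 x = 0.
Proof. by have := dsv_linl (-1) 0 0 x; rewrite scaler0 addr0 scaleN1r addNr. Qed.
Lemma dsv_lie0r x : dsv_lie x 0 = 0.
Proof. by have := dsv_linr (-1) 0 0 x; rewrite scaler0 addr0 scaleN1r addNr. Qed.
Lemma dsv_lieZl a x y : dsv_lie (a *: x) y = a *: dsv_lie x y.
Proof. by have := dsv_linl a x 0 y; rewrite dsv_lie0l !addr0. Qed.
Lemma dsv_lieZr a x y : dsv_lie y (a *: x) = a *: dsv_lie y x.
Proof. by have := dsv_linr a x 0 y; rewrite dsv_lie0r !addr0. Qed.
Lemma dsv_lieDr x y z : dsv_lie z (x + y) = dsv_lie z x + dsv_lie z y.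
Proof. by have := dsv_linr 1 x y z; rewrite !scale1r. Qed.
Lemma dsv_lieNr x y : dsv_lie y (- x) = - dsv_lie y x.
Proof. by rewrite -scaleN1r dsv_lieZr scaleN1r. Qed.

Lemma dsv_brk_anti g h : dsv_brk g h + dsv_brk h g = 0.
Proof.
case: g h => [m|m|m|] [n|n|n|] /=; rewrite ?addr0 ?subrr ?addNr //.
- rewrite (addrC n m) addrACA -!scalerDl.
  have -> : (n - m)%:~R + (m - n)%:~R = 0 :> K by rewrite !intrB; ring.
  rewrite scale0r add0r; case: eqP => [mn|_]; last by rewrite addr0 scale0r.
  have -> : n = - m by lia.
  by rewrite -mulrDl -intrD [X in X%:~R](_ : _ = 0) ?mul0r ?scale0r //; ring.
- rewrite (addrC n m) -scalerDl.
  have -> : (m - n)%:~R + (n - m)%:~R = 0 :> K by rewrite !intrB; ring.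
  by rewrite scale0r.
Qed.

Lemma dsv_anti x y : dsv_lie x y + dsv_lie y x = 0.
Proof.
elim/dsv_ind: x => [|a g x IHx]; first by rewrite dsv_lie0l dsv_lie0r addr0.
rewrite dsv_linl dsv_linr addrACA IHx addr0 -scalerDr; clear IHx x.
elim/dsv_ind: y => [|b h y IHy]; first by rewrite dsv_lie0l dsv_lie0r addr0 scaler0.
rewrite dsv_linl dsv_linr addrACA scalerDr IHy addr0 -scalerDr !dsv_lieE.
by rewrite dsv_brk_anti !scaler0.
Qed.

Fact dsv_xx x : dsv_lie x x = 0.
Proof.
have /eqP := dsv_anti x x.
by rewrite -mulr2n -scaler_nat scaler_eq0 pnatr_eq0 /= => /eqP.
Qed.

Fact dsv_jacobi x y z :
  dsv_lie x (dsv_lie y z) + dsv_lie y (dsv_lie z x) +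
  dsv_lie z (dsv_lie x y) = 0.
Proof.
apply: (@jacobi_of_basis K lam mu _ dsv_lie dsv).
- exact: dsv_linr.
- by move=> ? ?; rewrite dsv_lieE.
- by move=> ? ?; rewrite dsv_lieE.
- by move=> ? ?; rewrite dsv_lieE.
- by move=> ? ?; rewrite dsv_lieE.
- by move=> ? ?; rewrite dsv_lieE.
- by move=> ? ?; rewrite dsv_lieE.
- by move=> ? ?; rewrite dsv_lieE.
- by move=> ? ?; rewrite dsv_lieE.
- by move=> ? ?; rewrite dsv_lieE.
- by case=> [?|?|?|]; rewrite dsv_lieE.
- by case=> [?|?|?|]; rewrite dsv_lieE.
- exact: dsv_linl.
- exact: dsv_ind.
Qed.

HB.instance Definition _ := isLieAlgebra.Build K (DSV lam mu)
  dsv_linl dsv_linr dsv_xx dsv_jacobi.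

(* The linear span of the basis elements satisfying B. *)
Definition dsv_span (B : pred gen) : {pred DSV lam mu} :=
  [pred x : DSV lam mu | all B (msupp (x : {malg K[gen]}))].

Lemma dsv_spanP (B : pred gen) (x : DSV lam mu) :
  reflect (forall g, (x : {malg K[gen]})@_g != 0 -> B g) (x \in dsv_span B).
Proof.
rewrite inE; apply: (iffP allP) => h g.
  by rewrite mcoeff_neq0; apply: h.
by rewrite -mcoeff_neq0; apply: h.
Qed.

Lemma dsv_span_closed (B : pred gen) : submod_closed (dsv_span B).
Proof.
split=> [|a x y /dsv_spanP hx /dsv_spanP hy]; apply/dsv_spanP => g.
  by rewrite mcoeff0 eqxx.
rewrite mcoeffD mcoeffZ; have [x0|/hx //] := eqVneq (x : {malg K[gen]})@_g 0.
by rewrite x0 mulr0 add0r; apply: hy.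
Qed.

Lemma dsv_span_basis (B : pred gen) g : B g -> dsv g \in dsv_span B.
Proof.
move=> Bg; apply/dsv_spanP => h; rewrite mcoeffU.
by case: (eqVneq g h) => [<- //|_]; rewrite mulr0n eqxx.
Qed.

Section SpanOperations.
Variable B : pred gen.
Lemma dsv_span0 : 0 \in dsv_span B.
Proof. by case: (dsv_span_closed B). Qed.
Lemma dsv_spanZD a x y :
  x \in dsv_span B -> y \in dsv_span B -> a *: x + y \in dsv_span B.
Proof. by case: (dsv_span_closed B) => _; apply. Qed.
Lemma dsv_spanZ a x : x \in dsv_span B -> a *: x \in dsv_span B.
Proof. by move=> hx; rewrite -[a *: x]addr0; apply: dsv_spanZD => //; exact: dsv_span0. Qed.
Lemma dsv_spanN x : x \in dsv_span B -> - x \in dsv_span B.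
Proof. by move=> hx; rewrite -scaleN1r; apply: dsv_spanZ. Qed.

Lemma dsv_ext_span (f : gen -> DSV lam mu) x :
  (forall g, B g -> f g \in dsv_span B) ->
  x \in dsv_span B -> dsv_ext f x \in dsv_span B.
Proof.
move=> hf; rewrite inE => /allP; rewrite /dsv_ext.
elim: (enum_fset _) => [|g s IH] hs; first by rewrite big_nil dsv_span0.
rewrite big_cons; apply: dsv_spanZD; first by apply/hf/hs; rewrite mem_head.
by apply: IH => h hh; apply: hs; rewrite inE hh orbT.
Qed.

Lemma dsv_span_lie :
  (forall g h, B g -> B h -> dsv_brk g h \in dsv_span B) ->
  {in dsv_span B &, forall x y, dsv_lie x y \in dsv_span B}.
Proof.
move=> hB x y hx hy; apply: dsv_ext_span => // g Bg.
by apply: dsv_ext_span => // h; apply: hB.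
Qed.
End SpanOperations.

Definition sub_basis (d1 d2 : nat) (g : gen) : bool :=
  match g with
  | gL m => 0 <= m
  | gM m => - d1%:Z <= m
  | gY m => 1 - d2%:Z <= m
  | gC => true
  end.

Fact sub_basis_closed (d1 d2 : nat) (hd : (2 * d2 - 1 <= d1)%N) :
  {in dsv_span (sub_basis d1 d2) &,
    forall x y : DSV lam mu, lie x y \in dsv_span (sub_basis d1 d2)}.
Proof.
apply: dsv_span_lie => -[m|m|m|] [n|n|n|] /= hm hn;
  rewrite ?dsv_span0 //; try apply: dsv_spanN; try apply: dsv_spanZ;
  try (by apply: dsv_span_basis => /=; lia).
apply: dsv_spanZD; last apply: dsv_spanZ; apply: dsv_span_basis => //=; lia.
Qed.

(* The subalgebra G^(d1,d2); since 2 * d2 - 1 is truncated at 0, the hypothesis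
   is d1 >= 2 d2 - 1 also when d2 = 0. *)
Definition dsv_sub (d1 d2 : nat) (hd : (2 * d2 - 1 <= d1)%N) :
    lieSub (DSV lam mu) :=
  LieSub (dsv_span_closed (sub_basis d1 d2)) (sub_basis_closed hd).

Definition gdeg (g : gen) : rat :=
  match g with
  | gL m => m%:Q
  | gM m => m%:Q
  | gY m => m%:Q - 1 / 2
  | gC => 0
  end.

Definition dsv_homog (r : rat) : {pred DSV lam mu} :=
  dsv_span [pred g | gdeg g == r].

Definition restricted (P : lieModType (DSV lam mu)) : Prop :=
  forall v : P, exists n : nat, forall k : nat, (0 < k)%N ->
    forall x : DSV lam mu, x \in dsv_homog (n%:R + k%:R / 2) -> lact x v = 0.

Definition Gamma1 : Prop :=
  forall t i : nat, (0 < i)%N ->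
    ((lam + 1) * i%:R + t%:R + 2 * mu) *
    (i%:R + lam * (i%:R + t%:R) - 2 * mu) <> 0.

End DSVAlgebra.

Arguments dsv {K lam mu}.

(* For x in L and a module V over a subalgebra S of L: x belongs to S and acts
   on V injectively, by zero, by the scalar c. *)
Section ElementAction.
Variables (K : fieldType) (L : lieAlgType K) (S : lieSub L).
Variable V : lieModType (lsub_type S).

Definition acts_injectively (x : L) : Prop :=
  exists2 y : lsub_type S, lsub_val y = x & injective (lact y : V -> V).
Definition acts_by_zero (x : L) : Prop :=
  exists2 y : lsub_type S, lsub_val y = x & forall v : V, lact y v = 0.
Definition acts_by_scalar (x : L) (c : K) : Prop :=
  exists2 y : lsub_type S, lsub_val y = x & forall v : V, lact y v = c *: v.

End ElementAction.

(* Main.v *)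
(* Let t be the least natural number for which some nonzero vector of P is
   killed by all M_i with i > t; since some M_a is injective, M_t is injective on the space K1 of
   vectors killed by all M_i, i > t.  Let K2 be the subspace of K1 killed by the
   Y_{j-1/2} with j > t + d2, and V the subspace of K2 killed by the L_k with
   k > t + d1; since P is restricted, V is nonzero for suitable d1, d2.
   The basis elements missing from G^(d1,d2) are dual to the annihilating ones:
   (L_{-i}, M_{t+i}), (Y_{-d2-s-1/2}, Y_{t+d2+s+1/2}) and
   (M_{-d1-i}, L_{t+d1+i}) have as commutators multiples of M_t, nonzero by
   Gamma_1.  Hence, in the manner of a Weyl algebra, a vector of K1 that is
   written with words in the missing L's over K1 already lies in the
   coefficient space, and likewise for the missing Y's over K2 and the missing
   M's over V.  Words L Y M over V span a submodule, so this shows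
   both that Ind(V) -> P is injective (no PBW theorem is needed: spanning of
   Ind(V) by these words suffices) and that the submodule of P generated by
   V' <= V meets V in V', i.e. that V is simple. *)
Require Import Defs.
From HB Require Import structures.
From mathcomp Require Import all_boot all_order all_algebra.
From mathcomp Require Import reals complex.
From mathcomp Require Import boolp ring zify.

Set Implicit Arguments.
Unset Strict Implicit.
Unset Printing Implicit Defensive.

Import Order.TTheory GRing.Theory Num.Theory.
Local Open Scope ring_scope.

(** * Subspaces and linearity of the action *)

Definition subspace (K : fieldType) (V : lmodType K) (A : V -> Prop) : Prop :=
  A 0 /\ forall (a : K) v w, A v -> A w -> A (a *: v + w).

Section Subspace.
Variables (K : fieldType) (V : lmodType K) (A : V -> Prop).
Hypothesis sA : subspace A.

Lemma subspace0 : A 0. Proof. by case: sA. Qed.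
Lemma subspaceD v w : A v -> A w -> A (v + w).
Proof. by case: sA => _ h Av Aw; rewrite -[v]scale1r; apply: h. Qed.
Lemma subspaceZ a v : A v -> A (a *: v).
Proof. by case: sA => A0 h Av; rewrite -[_ *: _]addr0; apply: h. Qed.
Lemma subspaceN v : A v -> A (- v).
Proof. by rewrite -scaleN1r; apply: subspaceZ. Qed.
Lemma subspaceB v w : A v -> A w -> A (v - w).
Proof. by move=> Av /subspaceN; apply: subspaceD. Qed.
Lemma subspace_sum I (r : seq I) (Q : pred I) (F : I -> V) :
  (forall i, Q i -> A (F i)) -> A (\sum_(i <- r | Q i) F i).
Proof. by move=> h; elim/big_rec: _ => [|i v Qi Av]; [exact: subspace0 | apply/subspaceD/Av/h]. Qed.
End Subspace.

Section Action.
Variables (K : fieldType) (L : lieAlgType K) (V : lieModType L).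
Implicit Types (x y : L) (v w : V).

Lemma lact0 x : lact x (0 : V) = 0.
Proof. by have := lact_linr (-1) x (0 : V) 0; rewrite scaler0 addr0 scaleN1r addNr. Qed.
Lemma lactD x v w : lact x (v + w) = lact x v + lact x w.
Proof. by have := lact_linr 1 x v w; rewrite !scale1r. Qed.
Lemma lactZ x a v : lact x (a *: v) = a *: lact x v.
Proof. by have := lact_linr a x v 0; rewrite lact0 !addr0. Qed.
Lemma lactN x v : lact x (- v) = - lact x v.
Proof. by rewrite -scaleN1r lactZ scaleN1r. Qed.
Lemma lactB x v w : lact x (v - w) = lact x v - lact x w.
Proof. by rewrite lactD lactN. Qed.
Lemma lact0l v : lact 0 v = 0.
Proof. by have := lact_linl (-1) 0 0 v; rewrite scaler0 addr0 scaleN1r addNr. Qed.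
Lemma lactZl a x v : lact (a *: x) v = a *: lact x v.
Proof. by have := lact_linl a x 0 v; rewrite lact0l !addr0. Qed.
Lemma lactNl x v : lact (- x) v = - lact x v.
Proof. by rewrite -scaleN1r lactZl scaleN1r. Qed.
Lemma lact_sum x I (r : seq I) (Q : pred I) (F : I -> V) :
  lact x (\sum_(i <- r | Q i) F i) = \sum_(i <- r | Q i) lact x (F i).
Proof. exact: (big_morph _ (lactD x) (lact0 x)). Qed.

Lemma lact_comm x y v : lact x (lact y v) = lact y (lact x v) + lact (lie x y) v.
Proof. by rewrite lact_lie addrC subrK. Qed.
End Action.

(** * Words in a sequence of Lie algebra elements *)

Section WordSpan.
Variables (K : fieldType) (L : lieAlgType K) (Q : lieModType L).
Variables (x : nat -> L) (A : Q -> Prop).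

Inductive gspan : Q -> Prop :=
  | gspan_base v : A v -> gspan v
  | gspan_lin a v w : gspan v -> gspan w -> gspan (a *: v + w)
  | gspan_act j v : gspan v -> gspan (lact (x j) v).

(* Words of length strictly less than r: [wspan 0] is zero, [wspan 1] is A. *)
Inductive wspan : nat -> Q -> Prop :=
  | wspan_zero r : wspan r 0
  | wspan_lin r a v w : wspan r v -> wspan r w -> wspan r (a *: v + w)
  | wspan_base r v : A v -> wspan r.+1 v
  | wspan_act r j v : wspan r v -> wspan r.+1 (lact (x j) v).

Definition word (b : seq nat) (v : Q) : Q := foldr (fun j => lact (x j)) v b.

Hypothesis sA : subspace A.

Lemma gspan_subspace : subspace gspan.
Proof. by split; [apply/gspan_base/(subspace0 sA) | exact: gspan_lin]. Qed.

Lemma wspan_subspace r : subspace (wspan r).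
Proof. by split; [exact: wspan_zero | move=> *; exact: wspan_lin]. Qed.

Lemma wspan0 w : wspan 0 w -> w = 0.
Proof.
move E: 0%N => r h; elim: h E => // {}r a v w' _ IHv _ IHw E.
by rewrite IHv // IHw // scaler0 addr0.
Qed.

Lemma wspan_mono r s w : (r <= s)%N -> wspan r w -> wspan s w.
Proof.
move=> + h; elim: h s => {r w} [r|r a v w _ IHv _ IHw|r v Av|r j v _ IH] s rs.
- exact: wspan_zero.
- by apply: wspan_lin; [exact: IHv | exact: IHw].
- by case: s rs => // s _; apply: wspan_base.
- by case: s rs => // s rs; apply/wspan_act/IH.
Qed.

Lemma gspan_wspan w : gspan w -> exists r, wspan r w.
Proof.
elim=> {w} [v Av|a v w _ [r hr] _ [s hs]|j v _ [r hr]].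
- by exists 1%N; apply: wspan_base.
- exists (maxn r s); apply: wspan_lin.
    by apply: wspan_mono hr; rewrite leq_maxl.
  by apply: wspan_mono hs; rewrite leq_maxr.
- by exists r.+1; apply: wspan_act.
Qed.

Lemma wspan1 w : wspan 1 w -> A w.
Proof.
move E: 1%N => r h; elim: h E => {r w} [r _|r a v w _ IHv _ IHw E|r v Av _|r j v hv _ [E]].
- exact: subspace0.
- by case: sA => _; apply; [exact: IHv | exact: IHw].
- by [].
- by rewrite -E in hv; rewrite (wspan0 hv) lact0; exact: subspace0.
Qed.

Lemma word_lin b a v w : word b (a *: v + w) = a *: word b v + word b w.
Proof. by elim: b => //= j b ->; rewrite lact_linr. Qed.
Lemma word0 b : word b 0 = 0.
Proof. by elim: b => //= j b ->; rewrite lact0. Qed.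
Lemma wordZ b a v : word b (a *: v) = a *: word b v.
Proof. by have := word_lin b a v 0; rewrite word0 !addr0. Qed.
Lemma wordD b v w : word b (v + w) = word b v + word b w.
Proof. by have := word_lin b 1 v w; rewrite !scale1r. Qed.
Lemma word_sum b I (r : seq I) (F : I -> Q) (P : pred I) :
  word b (\sum_(i <- r | P i) F i) = \sum_(i <- r | P i) word b (F i).
Proof. exact: (big_morph _ (wordD b) (word0 b)). Qed.

Lemma wspan_word b v : A v -> wspan (size b).+1 (word b v).
Proof. by move=> Av; elim: b => [|j b IH] /=; [apply: wspan_base | apply: wspan_act]. Qed.

(** Isolates the words of maximal length as a finite list, possibly with repetitions, so that a
    leading-term argument can run on it. *)
Lemma wspan_top r w : wspan r.+1 w ->
  exists2 l : seq (seq nat * Q),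
    (forall p, p \in l -> size p.1 = r /\ A p.2) &
    wspan r (w - \sum_(p <- l) word p.1 p.2).
Proof.
move E: r.+1 => s h; elim: h r E => {s w}.
- by move=> s r _; exists [::]; rewrite // big_nil subr0; exact: wspan_zero.
- move=> s a v w _ IHv _ IHw r E; have [l1 h1 w1] := IHv r E.
  have [l2 h2 w2] := IHw r E.
  exists ([seq (p.1, a *: p.2) | p <- l1] ++ l2).
    move=> p; rewrite mem_cat => /orP[/mapP[q ql ->]|]; last exact: h2.
    by have [? ?] := h1 q ql; split=> //=; apply: subspaceZ.
  rewrite big_cat big_map /= opprD addrACA.
  under eq_bigr => p _ do rewrite wordZ.
  by rewrite -scaler_sumr -scalerBr; apply: wspan_lin.
- move=> s v Av [|r] [_].
    exists [:: ([::], v)]; first by move=> p; rewrite inE => /eqP ->.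
    by rewrite big_seq1 subrr; exact: wspan_zero.
  by exists [::]; rewrite // big_nil subr0; exact: wspan_base.
- move=> s j v hv IH [|r] [E].
    rewrite -E in hv; rewrite (wspan0 hv) lact0.
    by exists [::]; rewrite // big_nil subr0; exact: wspan_zero.
  have [l hl wl] := IH r E.
  exists [seq (j :: p.1, p.2) | p <- l].
    by move=> p /mapP[q /hl[sq Aq] ->] /=; rewrite sq.
  by rewrite big_map /= -lact_sum -lactB; apply: wspan_act.
Qed.

End WordSpan.

(** * Reordering words modulo shorter ones *)

Section CommutingFamily.
Variables (K : fieldType) (L : lieAlgType K) (Q : lieModType L).
Variables (x : nat -> L) (m : int -> L) (A : Q -> Prop).
Hypothesis mA : forall n v, A v -> A (lact (m n) v).
Hypothesis lie_mx : forall n k, exists f n', lie (m n) (x k) = f *: m n'.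

(** Moving [m n] past a letter only adds a multiple of another [m n'], so the length never grows. *)
Lemma wspan_m r n w : wspan x A r w -> wspan x A r (lact (m n) w).
Proof.
move=> h; elim: h n => {r w} [r|r a v w _ IHv _ IHw|r v Av|r j v _ IH] n.
- by rewrite lact0; exact: wspan_zero.
- by rewrite lact_linr; apply: wspan_lin.
- by apply/wspan_base/mA.
- rewrite lact_comm addrC; have [f [n' ->]] := lie_mx n j.
  rewrite lactZl; apply: wspan_lin; last exact/wspan_act/IH.
  exact: wspan_mono (leqnSn r) _.
Qed.

Lemma word_m n b v : A v ->
  wspan x A (size b) (lact (m n) (word x b v) - word x b (lact (m n) v)).
Proof.
move=> Av; elim: b n => [|j b IH] n /=; first by rewrite subrr; exact: wspan_zero.
rewrite lact_comm addrAC -lactB addrC; have [f [n' ->]] := lie_mx n j.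
by rewrite lactZl; apply: wspan_lin; [exact/wspan_m/wspan_word | exact/wspan_act/IH].
Qed.

Hypothesis lie_xx : forall i j, exists a k b n,
  lie (x i) (x j) = a *: x k + b *: m n.

Lemma wspan_lie_xx r i j w : wspan x A r w -> wspan x A r.+1 (lact (lie (x i) (x j)) w).
Proof.
move=> hw; have [a [k [b [n ->]]]] := lie_xx i j.
rewrite lact_linl lactZl; apply: wspan_lin; first exact: wspan_act.
apply: (subspaceZ (wspan_subspace x A _)).
exact/wspan_m/(wspan_mono (leqnSn r)).
Qed.

(** Each exchange of neighbours costs a bracket, which by [lie_xx] is a letter plus a multiple of
    some [m n], hence leads to shorter words. *)
Lemma word_insert j b1 b2 v : A v ->
  wspan x A (size b1 + size b2).+1
    (word x (b1 ++ j :: b2) v - word x (j :: b1 ++ b2) v).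
Proof.
move=> Av; elim: b1 => [|i b1 IH] /=; first by rewrite subrr; exact: wspan_zero.
rewrite -[X in wspan _ _ _ (X - _)](subrK (lact (x i) (lact (x j) (word x (b1 ++ b2) v)))).
rewrite -addrA; apply: (subspaceD (wspan_subspace x A _)).
  by rewrite -lactB; apply: wspan_act; exact: IH.
rewrite lact_comm addrAC subrr add0r addSn -size_cat.
by apply: wspan_lie_xx; exact: wspan_word.
Qed.

Lemma word_perm b b' v : perm_eq b b' -> A v ->
  wspan x A (size b) (word x b v - word x b' v).
Proof.
move=> + Av; elim: b b' => [|j b IH] b' pb.
  move: pb; rewrite perm_sym => /perm_nilP ->.
  by rewrite subrr; exact: wspan_zero.
have [b1 [b2 Eb']] : exists b1 b2, b' = b1 ++ j :: b2.
  have : j \in b' by rewrite -(perm_mem pb) mem_head.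
  by case/splitPr => b1 b2; exists b1, b2.
have pb' : perm_eq b (b1 ++ b2).
  move: pb; rewrite Eb' perm_sym -cat1s perm_catCA /= perm_cons perm_sym.
  by [].
have sb : size b = (size b1 + size b2)%N by rewrite (perm_size pb') size_cat.
rewrite -[word x (j :: b) v](subrK (word x (j :: b1 ++ b2) v)) -addrA.
apply: (subspaceD (wspan_subspace x A _)).
  by rewrite /= -lactB; apply/wspan_act/IH.
rewrite Eb' -opprB /= sb; apply: (subspaceN (wspan_subspace x A _)).
exact: word_insert.
Qed.

End CommutingFamily.

(** * Descent for words of bounded length *)

Definition del (s : nat) (b : seq nat) := take s b ++ drop s.+1 b.

Lemma perm_del s (b : seq nat) : (s < size b)%N -> perm_eq b (nth 0%N b s :: del s b).
Proof.
move=> sb; rewrite -[X in perm_eq X](cat_take_drop s) (drop_nth 0%N) //.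
by rewrite -cat1s perm_catCA.
Qed.

Section Pairing.
Variables (K : numFieldType) (L : lieAlgType K) (P : lieModType L).
Variables (x d : nat -> L) (m : int -> L) (t : int) (e : nat -> nat -> K).
Variables (A : P -> Prop).
Hypothesis mA : forall n v, A v -> A (lact (m n) v).
Hypothesis mA0 : forall n v, t < n -> A v -> lact (m n) v = 0.
Hypothesis dA : forall i v, A v -> lact (d i) v = 0.
Hypothesis lie_mx : forall n k, exists f n', lie (m n) (x k) = f *: m n'.
Hypothesis lie_dx : forall i j : nat, lie (d i) (x j) = e i j *: m (t + i%:Z - j%:Z).

(** Pushing [d i] to the right turns one letter into a multiple of some [m n], which passes through
    the others, and [d i] itself dies on [A]; so one letter is lost. *)
Lemma wspan_d r i w : wspan x A r w -> wspan x A r.-1 (lact (d i) w).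
Proof.
move=> h; elim: h => {r w} [r|r a v w _ IHv _ IHw|r v Av|r j v hv IH].
- by rewrite lact0; exact: wspan_zero.
- by rewrite lact_linr; apply: wspan_lin.
- by rewrite dA //; exact: wspan_zero.
- rewrite lact_comm lie_dx lactZl addrC; apply: wspan_lin; first exact: wspan_m.
  case: r hv IH => [/wspan0 ->|r hv IH] /=; last exact: wspan_act.
  by rewrite !lact0 => _; exact: wspan_zero.
Qed.

(** The Leibniz rule. Carrying each [m] through to the coefficient costs words with at least two
    letters fewer than [b], which the error term absorbs. *)
Lemma word_d i b v : A v ->
  wspan x A (size b).-1 (lact (d i) (word x b v) -
    \sum_(s < size b) e i (nth 0%N b s) *:
       word x (del s b) (lact (m (t + i%:Z - (nth 0%N b s)%:Z)) v)).
Proof.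
move=> Av; elim: b => [|j b IH] /=.
  by rewrite big_ord0 subr0 dA //; exact: wspan_zero.
rewrite lact_comm [lact _ _ + _]addrC big_ord_recl /= opprD addrACA lie_dx lactZl.
rewrite -scalerBr; apply: wspan_lin; first by rewrite /del take0 drop1; exact: word_m.
under eq_bigr => s _ do rewrite -lactZ.
rewrite -lact_sum -lactB.
case: b IH => [|j' b] /= IH; last exact: wspan_act.
by rewrite big_ord0 subr0 dA // lact0; exact: wspan_zero.
Qed.

(** Dual to [word]: the head of [g] acts first, whereas the head of [b] in [word x b] acts last. *)
Fixpoint coword (g : seq nat) (w : P) : P :=
  if g is i :: g' then coword g' (lact (d i) w) else w.

Lemma coword_lin g a v w : coword g (a *: v + w) = a *: coword g v + coword g w.
Proof. by elim: g v w => //= i g IH v w; rewrite lact_linr IH. Qed.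
Lemma coword0 g : coword g 0 = 0.
Proof. by elim: g => //= i g IH; rewrite lact0. Qed.
Lemma cowordZ g a v : coword g (a *: v) = a *: coword g v.
Proof. by have := coword_lin g a v 0; rewrite coword0 !addr0. Qed.
Lemma cowordD g v w : coword g (v + w) = coword g v + coword g w.
Proof. by have := coword_lin g 1 v w; rewrite !scale1r. Qed.
Lemma coword_sum g I (r : seq I) (F : I -> P) (p : pred I) :
  coword g (\sum_(i <- r | p i) F i) = \sum_(i <- r | p i) coword g (F i).
Proof. exact: (big_morph _ (cowordD g) (coword0 g)). Qed.

(** Each [d i] shortens words by one letter, so [size g] of them exhaust any word with fewer
    letters. *)
Lemma coword_wspan g r w : (r <= size g)%N -> wspan x A r w -> coword g w = 0.
Proof.
elim: g r w => [|i g IH] r w /=; first by rewrite leqn0 => /eqP -> /wspan0.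
by move=> rg hw; apply: IH (wspan_d i hw); case: r rg {hw}.
Qed.

(** Each head is counted with itself included, so this is the product of the factorials of the
    multiplicities in [g], times the product of the [e i i]. *)
Fixpoint kappa (g : seq nat) : K :=
  if g is i :: g' then (count_mem i g)%:R * e i i * kappa g' else 1.

Lemma pairing g b v : A v -> size b = size g -> (sumn b <= sumn g)%N ->
  coword g (word x b v) = if perm_eq b g then kappa g *: iter (size g) (lact (m t)) v else 0.
Proof.
elim: g b v => [|i g IH] b v Av; first by case: b => //= _ _; rewrite scale1r.
move=> sb hb; have := word_d i b Av.
rewrite sb /= => /(coword_wspan (leqnn _)) /eqP.
rewrite -scaleN1r addrC coword_lin scaleN1r addrC subr_eq0 => /eqP ->.
rewrite coword_sum.
have tE (s : 'I_(size g).+1) : coword g (e i (nth 0%N b s) *: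
    word x (del s b) (lact (m (t + i%:Z - (nth 0%N b s)%:Z)) v)) =
    if nth 0%N b s == i then e i i *:
      (if perm_eq b (i :: g) then kappa g *: iter (size g) (lact (m t)) (lact (m t) v)
       else 0) else 0.
  have sltb : (s < size b)%N by rewrite sb.
  have pb := perm_del sltb.
  have sumb := perm_sumn pb; rewrite /= in sumb.
  have sdel : size (del s b) = size g by move: sb; rewrite (perm_size pb) => -[].
  rewrite cowordZ; case: (ssrnat.ltngtP (nth 0%N b s) i) => [lti|gti|E].
  - by rewrite mA0 ?word0 ?coword0 ?scaler0 //; lia.
  - rewrite IH //; [|exact: mA|by move: hb => /=; lia].
    case: ifP => [/perm_sumn E|]; last by rewrite scaler0.
    by move: hb => /=; lia.
  - rewrite E (_ : t + _ - _ = t); last by ring.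
    rewrite IH //; [|exact: mA|by move: hb; rewrite /= sumb E; lia].
    by rewrite (permPl pb) E perm_cons.
under eq_bigr => s _ do rewrite tE.
rewrite -big_mkcond /= sumr_const.
(* The positions of [b] carrying [i] contribute equally; their number is the multiplicity in
   [kappa]. *)
have cE : #|(fun s : 'I_(size g).+1 => nth 0%N b s == i)| = count_mem i b.
  rewrite -sum1_card -sum1_count (big_nth 0%N) big_mkord.
  by rewrite sb.
rewrite cE; case: ifP => [pb|_]; last by rewrite scaler0 mul0rn.
rewrite (permP pb) /= -scaler_nat !scalerA -iterSr; congr (_ *: _).
by rewrite mulrA.
Qed.

Hypothesis e_neq0 : forall i, e i i != 0.
Hypothesis m_inj : forall v, A v -> lact (m t) v = 0 -> v = 0.

Lemma kappa_neq0 g : kappa g != 0.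
Proof.
elim: g => [|i g IH] /=; first exact: oner_neq0.
by rewrite !mulf_neq0 // eqxx pnatr_eq0.
Qed.

Lemma iter_m_inj r v : A v -> iter r (lact (m t)) v = 0 -> v = 0.
Proof.
elim: r v => //= r IH v Av; rewrite -iterS iterSr => /IH h.
by apply: m_inj => //; apply: h; exact: mA.
Qed.

End Pairing.

Lemma exists_argmax (T : eqType) (f : T -> nat) (s : seq T) : s != [::] ->
  exists2 x, x \in s & forall y, y \in s -> (f y <= f x)%N.
Proof.
elim: s => // x [|x' s] IH _; first by exists x => [|y]; rewrite inE // => /eqP ->.
have [//|y ys ymax] := IH; have [le|/ltnW le] := leqP (f x) (f y).
  exists y => [|y']; first by rewrite inE ys orbT.
  by rewrite inE => /orP[/eqP -> //|/ymax].
exists x => [|y']; first exact: mem_head.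
by rewrite inE => /orP[/eqP -> //|/ymax/leq_trans]; apply.
Qed.

Section Morphism.
Variables (K : fieldType) (L : lieAlgType K) (Q P : lieModType L) (phi : Q -> P).
Hypothesis phi_lin : forall (a : K) v w, phi (a *: v + w) = a *: phi v + phi w.
Hypothesis phi_act : forall (y : L) v, phi (lact y v) = lact y (phi v).

Lemma morph0 : phi 0 = 0.
Proof. by have := phi_lin (-1) 0 0; rewrite scaler0 addr0 scaleN1r addNr. Qed.
Lemma morphD v w : phi (v + w) = phi v + phi w.
Proof. by have := phi_lin 1 v w; rewrite !scale1r. Qed.
Lemma morphB v w : phi (v - w) = phi v - phi w.
Proof. by rewrite addrC -scaleN1r phi_lin scaleN1r addrC. Qed.
Lemma morph_sum I (r : seq I) (p : pred I) (F : I -> Q) :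
  phi (\sum_(i <- r | p i) F i) = \sum_(i <- r | p i) phi (F i).
Proof. exact: (big_morph _ morphD morph0). Qed.
Lemma morph_word x b v : phi (word x b v) = word x b (phi v).
Proof. by elim: b => //= j b IH; rewrite phi_act IH. Qed.

Lemma morph_wspan x (A : Q -> Prop) (B : P -> Prop) r w :
  (forall v, A v -> B (phi v)) -> wspan x A r w -> wspan x B r (phi w).
Proof.
move=> AB; elim=> {r w} [r|r a v w _ IHv _ IHw|r v Av|r j v _ IH].
- by rewrite morph0; apply: wspan_zero.
- by rewrite phi_lin; apply: wspan_lin.
- by apply/wspan_base/AB.
- by rewrite phi_act; apply: wspan_act.
Qed.

Lemma morph_gspan x (A : Q -> Prop) (B : P -> Prop) w : subspace B ->
  (forall v, A v -> B (phi v)) -> (forall j v, B v -> B (lact (x j) v)) ->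
  gspan x A w -> B (phi w).
Proof.
move=> sB AB xB; elim=> {w} [v|a v w _ Bv _ Bw|j v _]; first exact: AB.
  by rewrite phi_lin; case: sB => _; apply.
by rewrite phi_act; apply: xB.
Qed.
End Morphism.

(** * Descent along a module morphism *)

Section WordDescent.
Variables (K : numFieldType) (L : lieAlgType K) (Q P : lieModType L) (phi : Q -> P).
Hypothesis phi_lin : forall (a : K) v w, phi (a *: v + w) = a *: phi v + phi w.
Hypothesis phi_act : forall (y : L) v, phi (lact y v) = lact y (phi v).
Variables (x d : nat -> L) (m : int -> L) (t : int) (e : nat -> nat -> K).
Variables (A : Q -> Prop) (B : P -> Prop).
Hypothesis sA : subspace A.
Hypothesis lie_mx : forall n k, exists f n', lie (m n) (x k) = f *: m n'.
Hypothesis lie_xx : forall i j, exists a k b n,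
  lie (x i) (x j) = a *: x k + b *: m n.
Hypothesis lie_dx : forall i j : nat, lie (d i) (x j) = e i j *: m (t + i%:Z - j%:Z).
Hypothesis e_neq0 : forall i, e i i != 0.
Hypothesis mA : forall n v, A v -> A (lact (m n) v).
Hypothesis mB : forall n v, B v -> B (lact (m n) v).
Hypothesis mB0 : forall n v, t < n -> B v -> lact (m n) v = 0.
Hypothesis mB_inj : forall v, B v -> lact (m t) v = 0 -> v = 0.
Hypothesis dB : forall i v, B v -> lact (d i) v = 0.
Hypothesis AB : forall v, A v -> B (phi v).
Hypothesis phi_inj : forall v, A v -> phi v = 0 -> v = 0.

Lemma coword_kills g n w : size g = n -> wspan x A n w -> coword d g (phi w) = 0.
Proof.
move=> sg /(morph_wspan phi_lin phi_act AB).
by apply: (coword_wspan mB dB lie_mx lie_dx); rewrite sg.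
Qed.

(* Among the words of l, one whose letters have the largest sum pairs
   non-trivially with its own permutations only; their coefficients therefore
   add up to 0, and they can be removed from l at the cost of shorter words. *)
Lemma top_vanish n (l : seq (seq nat * Q)) :
  (forall p, p \in l -> size p.1 = n /\ A p.2) ->
  (forall g, size g = n -> coword d g (phi (\sum_(p <- l) word x p.1 p.2)) = 0) ->
  wspan x A n (\sum_(p <- l) word x p.1 p.2).
Proof.
elim: {l}(size l) {-2}l (leqnn (size l)) => [|k IH] l.
  by rewrite leqn0 => /nilP -> _ _; rewrite big_nil; exact: wspan_zero.
have [->|l0] := eqVneq l [::]; first by rewrite big_nil => *; exact: wspan_zero.
move=> sl hl hg; have [p0 p0l p0max] := exists_argmax (fun p => sumn p.1) l0.
pose g := p0.1; have [sg _] := hl _ p0l; rewrite -/g in sg.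
pose sim (p : seq nat * Q) := perm_eq p.1 g.
have u0 : \sum_(p <- l | sim p) p.2 = 0.
  have Au : A (\sum_(p <- l | sim p) p.2).
    rewrite big_seq_cond; apply: (subspace_sum sA) => p /andP[pl _].
    by have [] := hl p pl.
  apply: phi_inj => //; have := hg g sg.
  rewrite (morph_sum phi_lin) coword_sum big_seq.
  rewrite (eq_bigr (fun p => if sim p then
      kappa e g *: iter n (lact (m t)) (phi p.2) else 0)); last first.
    move=> p pl; have [sp Ap] := hl p pl; rewrite (morph_word phi_act).
    rewrite (pairing mB mB0 dB lie_mx lie_dx (AB Ap)) ?sg //.
    exact: p0max.
  rewrite -big_mkcondr -big_seq_cond -scaler_sumr.
  have zD : {morph iter n (lact (m t) : P -> P) : v w / v + w}.
    by move=> v w; elim: n {IH hl hg sg} => //= n ->; rewrite lactD.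
  have z0 : iter n (lact (m t) : P -> P) 0 = 0.
    by elim: n {IH hl hg sg zD} => //= n ->; rewrite lact0.
  rewrite -(big_morph _ zD z0).
  rewrite -(morph_sum phi_lin) => /eqP; rewrite scaler_eq0.
  rewrite (negbTE (kappa_neq0 e_neq0 g)) /= => /eqP.
  by apply: (iter_m_inj mB mB_inj); apply: AB.
have low : wspan x A n (\sum_(p <- l | sim p) word x p.1 p.2).
  (* Subtracting the word [g] applied to the coefficient sum [u0 = 0] changes nothing, but makes
     each term a difference of permuted words. *)
  have : \sum_(p <- l | sim p) word x p.1 p.2 -
      word x g (\sum_(p <- l | sim p) p.2) = \sum_(p <- l | sim p) word x p.1 p.2.
    by rewrite u0 word0 subr0.
  rewrite word_sum -sumrB => <-; rewrite big_seq_cond.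
  apply: (subspace_sum (wspan_subspace x A n)) => p /andP[pl pg].
  by have [sp Ap] := hl p pl; rewrite -sp; apply: (word_perm mA lie_mx lie_xx).
rewrite (bigID sim) /=; apply: (subspaceD (wspan_subspace x A n)) => //.
rewrite -big_filter; apply: IH.
- rewrite -ltnS; apply: leq_trans sl; rewrite size_filter ltn_neqAle count_size andbT.
  rewrite -all_count; apply/allPn; exists p0 => //=.
  by rewrite negbK; exact: perm_refl.
- by move=> p; rewrite mem_filter => /andP[_]; apply: hl.
- move=> g' sg'; have := hg g' sg'.
  rewrite (bigID sim) /= (morphD phi_lin) cowordD (coword_kills sg' low) add0r.
  by rewrite big_filter.
Qed.

(** Induction on the length bound: every [d i] kills [phi w] and cowords of top length kill shorter
    words, so they vanish on the top part, which [top_vanish] then shortens. The morphism [phi]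
    serves two uses: the identity of P for the simplicity of V, and Ind(V) -> P for injectivity. *)
Lemma word_descent w : gspan x A w -> B (phi w) -> A w.
Proof.
case/gspan_wspan => -[/wspan0 -> _|r]; first exact: (subspace0 sA).
elim: r => [|r IH] hw Bw; first exact: (wspan1 sA hw).
apply: IH => //; have [l hl wl] := wspan_top sA hw.
rewrite -[w](subrK (\sum_(p <- l) word x p.1 p.2)).
apply: (subspaceD (wspan_subspace x A r.+1)) => //.
apply: top_vanish => // g sg.
have := coword_kills sg wl; rewrite (morphB phi_lin) -scaleN1r addrC coword_lin.
(* [g] has r + 1 > 0 entries, and its head already kills [phi w]. *)
case: g sg => // i g sg; rewrite /= (dB _ Bw) coword0 addr0 scaleN1r.
by move/eqP; rewrite oppr_eq0 => /eqP.
Qed.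
End WordDescent.

(** * Descent for commuting letters *)

Section PolynomialsIn.
Variables (K : fieldType) (L : lieAlgType K) (Q : lieModType L).
Variables (y : L) (T : Q -> Prop).

(** Polynomials in [y] of degree less than [n] with coefficients in [T]; the coefficients may fail
    to be unique. *)
Fixpoint poly_in (n : nat) (w : Q) : Prop :=
  if n is n'.+1 then
    exists w' a, [/\ poly_in n' w', T a & w = w' + iter n' (lact y) a]
  else w = 0.

Hypothesis sT : subspace T.

Lemma iter_lact_lin n a v w :
  iter n (lact y) (a *: v + w) = a *: iter n (lact y) v + iter n (lact y) w :> Q.
Proof. by elim: n => //= n ->; rewrite lact_linr. Qed.

Lemma iter_lact0 n : iter n (lact y) 0 = 0 :> Q.
Proof. by elim: n => //= n ->; rewrite lact0. Qed.

Lemma poly_in_subspace n : subspace (poly_in n).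
Proof.
elim: n => [|n [IH0 IH]]; first by split=> // a v w -> ->; rewrite scaler0 addr0.
split; first by exists 0, 0; split=> //; [exact: subspace0 | rewrite iter_lact0 addr0].
move=> c _ _ [v [a [hv Ta ->]]] [w [b [hw Tb ->]]].
exists (c *: v + w), (c *: a + b); split; first exact: IH.
  by case: sT => _; apply.
by rewrite iter_lact_lin scalerDr addrACA.
Qed.

Lemma poly_inS n w : poly_in n w -> poly_in n.+1 w.
Proof. by exists w, 0; split=> //; [exact: subspace0 | rewrite iter_lact0 addr0]. Qed.

Lemma poly_in_mono n n' w : (n <= n')%N -> poly_in n w -> poly_in n' w.
Proof. by move=> /subnK <- hw; elim: (n' - n)%N => // k IH; apply: poly_inS. Qed.

Lemma poly_in_base a : T a -> poly_in 1 a.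
Proof. by move=> Ta; exists 0, a; rewrite add0r. Qed.

Lemma poly_in_var n w : poly_in n w -> poly_in n.+1 (lact y w).
Proof.
elim: n w => [|n IH] w; first by move=> ->; rewrite lact0; apply: poly_inS.
move=> [w' [a [hw Ta ->]]]; exists (lact y w'), a.
by rewrite lactD; split=> //; apply: IH.
Qed.

Lemma poly_in_comm u n w : lie u y = 0 -> (forall a, T a -> T (lact u a)) ->
  poly_in n w -> poly_in n (lact u w).
Proof.
move=> uy uT; elim: n w => [|n IH] w; first by move=> ->; rewrite lact0.
move=> [w' [a [hw Ta ->]]]; exists (lact u w'), (lact u a).
split; [exact: IH | exact: uT | rewrite lactD; congr (_ + _)].
by elim: (n) => //= k <-; rewrite lact_comm uy lact0l addr0.
Qed.
End PolynomialsIn.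

Section CommutingDescent.
Variables (K : numFieldType) (L : lieAlgType K) (Q P : lieModType L) (phi : Q -> P).
Hypothesis phi_lin : forall (a : K) v w, phi (a *: v + w) = a *: phi v + phi w.
Hypothesis phi_act : forall (y : L) v, phi (lact y v) = lact y (phi v).
Variables (x d : nat -> L) (u : L) (c : nat -> K).
Variables (A : Q -> Prop) (B C : P -> Prop).
Hypotheses (sA : subspace A) (sC : subspace C).
Hypothesis lie_xx : forall i j, lie (x i) (x j) = 0.
Hypothesis xC : forall j v, C v -> C (lact (x j) v).
Hypothesis uC : forall v, C v -> C (lact u v).
Hypothesis uC_inj : forall v, C v -> lact u v = 0 -> v = 0.
Hypothesis lie_dx0 : forall i j v, (j < i)%N -> C v -> lact (lie (d i) (x j)) v = 0.
Hypothesis lie_dx : forall i v, C v -> lact (lie (d i) (x i)) v = c i *: lact u v.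
Hypothesis lie_du : forall i v, C v -> lact (lie (d i) u) v = 0.
Hypothesis lie_ux : forall j, lie u (x j) = 0.
Hypothesis c_neq0 : forall i, c i != 0.
Hypothesis BC : forall v, B v -> C v.
Hypothesis dB : forall i v, B v -> lact (d i) v = 0.
Hypothesis AB : forall v, A v -> B (phi v).
Hypothesis phi_inj : forall v, A v -> phi v = 0 -> v = 0.
Hypothesis B0 : B 0.

(* The span of the words in the letters [x j] with j < n, as polynomials in
   [x n.-1] over the span of the words in the previous letters. *)
Fixpoint letters (n : nat) : Q -> Prop :=
  if n is n'.+1 then fun w => exists r, poly_in (x n') (letters n') r w else A.

Lemma letters_subspace n : subspace (letters n).
Proof.
elim: n => //= n IH; split; first by exists 0%N.
move=> a v w [r hr] [s hs]; exists (maxn r s).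
case: (poly_in_subspace (x n) IH (maxn r s)) => _; apply.
  by apply: poly_in_mono hr => //; rewrite leq_maxl.
by apply: poly_in_mono hs => //; rewrite leq_maxr.
Qed.

Lemma letters_mono n n' w : (n <= n')%N -> letters n w -> letters n' w.
Proof.
move=> /subnK <- hw; elim: (n' - n)%N => // k IH.
by exists 1%N; apply: poly_in_base.
Qed.

Lemma letters_act n j w : (j < n)%N -> letters n w -> letters n (lact (x j) w).
Proof.
elim: n w => // n IH w; rewrite ltnS leq_eqVlt => /orP[/eqP ->|jn] [r hr].
  by exists r.+1; apply: poly_in_var hr; apply: letters_subspace.
by exists r; apply: poly_in_comm hr => // a; apply: IH.
Qed.

Lemma gspan_letters w : gspan x A w -> exists n, letters n w.
Proof.
elim=> {w} [v Av|a v w _ [n hn] _ [k hk]|j v _ [n hn]].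
- by exists 0%N.
- exists (maxn n k); case: (letters_subspace (maxn n k)) => _; apply.
    by apply: letters_mono hn; rewrite leq_maxl.
  by apply: letters_mono hk; rewrite leq_maxr.
- exists (maxn n j.+1); apply: letters_act; first by rewrite leq_maxr.
  by apply: letters_mono hn; rewrite leq_maxl.
Qed.

Lemma iter_x_C n r v : C v -> C (iter r (lact (x n)) v).
Proof. by move=> Cv; elim: r => //= r; apply: xC. Qed.

Lemma iter_x_u n r v : iter r (lact (x n)) (lact u v) = lact u (iter r (lact (x n)) v) :> P.
Proof. by elim: r => //= r ->; rewrite [RHS]lact_comm lie_ux lact0l addr0. Qed.

Lemma morph_iter n r a : phi (iter r (lact (x n)) a) = iter r (lact (x n)) (phi a).
Proof. by elim: r => //= r IH; rewrite phi_act IH. Qed.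

(** For j < i the bracket of [d i] with [x j] kills [C]; hence [d i] with n <= i passes all letters
    below [n] and dies on the coefficient. *)
Lemma letters_C n w : letters n w ->
  C (phi w) /\ forall i, (n <= i)%N -> lact (d i) (phi w) = 0.
Proof.
elim: n w => [w /AB Bw|n IH w [r]].
  by split=> [|i _]; [exact: BC | exact: dB].
elim: r w => [|r IHr] w.
  by move=> ->; rewrite (morph0 phi_lin); split=> [|i _]; [exact: subspace0|exact: lact0].
move=> [w' [a [/IHr[Cw dw] /IH[Ca da] ->]]].
rewrite (morphD phi_lin) morph_iter; split=> [|i ni].
  by apply: (subspaceD sC) => //; apply: iter_x_C.
rewrite lactD dw // add0r; elim: (r) => [|k IHk] /=; first by apply/da/ltnW.
by rewrite lact_comm IHk lact0 add0r lie_dx0 //; apply: iter_x_C.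
Qed.

(** The r commutators are equal because [u] commutes with [x n]: this is the derivative of a
    power. *)
Lemma d_iter_x n r v : C v -> lact (d n) v = 0 ->
  lact (d n) (iter r (lact (x n)) v) =
    (r%:R * c n) *: iter r.-1 (lact (x n)) (lact u v).
Proof.
move=> Cv dv; elim: r => [|r IH]; first by rewrite /= dv mul0r scale0r.
rewrite iterS lact_comm IH lie_dx ?lactZ; last exact: iter_x_C.
rewrite -iter_x_u [r.+1.-1]/=; case: r {IH} => [|r]; last rewrite -iterS.
  by rewrite mul0r scale0r add0r mul1r.
by rewrite -scalerDl -{2}[c n]mul1r -mulrDl natr1.
Qed.

Lemma iter_d_x n k r v : C v -> lact (d n) v = 0 -> (r <= k)%N ->
  iter k (lact (d n)) (iter r (lact (x n)) v) =
    if r == k then (k`!%:R * c n ^+ k) *: iter k (lact u) v else 0.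
Proof.
have iterZ (y : L) i a (w : P) : iter i (lact y) (a *: w) = a *: iter i (lact y) w.
  by elim: i => //= i ->; rewrite lactZ.
elim: k r v => [|k IH] r v Cv dv.
  by rewrite leqn0 => /eqP -> /=; rewrite mul1r scale1r.
case: r => [|r] rk; rewrite iterSr d_iter_x // iterZ; first by rewrite mul0r scale0r.
(* The induction runs on [lact u v], which [d n] still kills since the bracket of [d n] and [u] is
   zero on [C]. *)
rewrite -[r.+1.-1]/r IH //; [|exact: uC|by rewrite lact_comm dv lact0 add0r lie_du].
rewrite eqSS; case: eqP => [->|_]; last by rewrite scaler0.
by rewrite scalerA -iterSr factS natrM exprS; congr (_ *: _); ring.
Qed.

Lemma iter_d_poly n r k w : (r <= k)%N -> poly_in (x n) (letters n) r w ->
  iter k (lact (d n)) (phi w) = 0.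
Proof.
elim: r w => [|r IH] w rk; first by move=> ->; rewrite (morph0 phi_lin) iter_lact0.
move=> [w' [a [hw Ta ->]]].
have [Ca /(_ n (leqnn n)) da] := letters_C Ta.
have iterD v v' : iter k (lact (d n)) (v + v') =
    iter k (lact (d n)) v + iter k (lact (d n)) v' :> P.
  by have := iter_lact_lin (d n) k 1 v v'; rewrite !scale1r.
rewrite (morphD phi_lin) iterD IH ?(ltnW rk) // add0r morph_iter iter_d_x ?(ltnW rk) //.
by rewrite ltn_eqF.
Qed.

Lemma iter_u_inj r v : C v -> iter r (lact u) v = 0 -> v = 0.
Proof.
elim: r v => // r IH v Cv; rewrite iterSr => /IH h.
by apply: uC_inj => //; apply: h; exact: uC.
Qed.

(* The operator [d n] annihilates the previous letters and acts as [c n u d/d(x n)],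
   so that it detects the leading coefficient in [x n]. *)
Lemma letters_descent n w : letters n w -> B (phi w) -> A w.
Proof.
elim: n w => // n IH w [r]; elim: r w => [|r IHr] w hw Bw.
  by rewrite hw; exact: subspace0.
case: hw => w' [a [hw Ta Ew]].
(* A polynomial of degree less than 1 is its constant term, which involves earlier letters only. *)
case: r IHr hw Ew => [|r] IHr hw Ew.
  by move: Bw; rewrite Ew hw add0r; apply: IH.
have [Ca /(_ n (leqnn n)) da] := letters_C Ta.
(* Applying [d n] r + 1 times kills [phi w] and [phi w']; what is left is a nonzero multiple of the
   (r+1)-st iterate of [u] on [phi a]. *)
have := iter_d_poly (leqnn r.+1) hw.
have : iter r.+1 (lact (d n)) (phi w) = 0 by rewrite iterSr dB // iter_lact0.
rewrite Ew (morphD phi_lin) -[phi w' + _]scale1r scalerDr.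
rewrite iter_lact_lin !scale1r => /[swap] ->; rewrite add0r morph_iter iter_d_x // eqxx.
move/eqP; rewrite scaler_eq0 mulf_eq0 expf_eq0 (negbTE (c_neq0 n)) andbF orbF.
rewrite pnatr_eq0 -leqn0 leqNgt fact_gt0 orFb => /eqP /(iter_u_inj Ca) pa0.
(* [phi a = 0] lies in [B], so the induction on [n] puts [a] in [A], where [phi] is injective. *)
have a0 : a = 0 by apply: phi_inj => //; apply: IH => //; rewrite pa0.
rewrite a0 iter_lact0 addr0; apply: IHr => //.
by move: Bw; rewrite Ew a0 iter_lact0 addr0.
Qed.

(** Meant for the letters M: there the brackets M_{t+i-j} can be letters themselves and need not
    preserve [A], as [word_descent] would require. Instead the letters are eliminated one at a time,
    the highest index first. *)
Lemma commuting_descent w : gspan x A w -> B (phi w) -> A w.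
Proof. by move=> /gspan_letters[n]; apply: letters_descent. Qed.

End CommutingDescent.

(** * The deformative Schrodinger-Virasoro algebra *)

Section DSVSpan.
Variables (K : numFieldType) (lam mu : K).
Local Notation G := (DSV lam mu).

Lemma dsv_span_ind (B : pred gen) (T : G -> Prop) : T 0 ->
  (forall a g y, B g -> T y -> T (a *: dsv g + y)) ->
  forall y, y \in dsv_span B -> T y.
Proof.
move=> T0 TS y; rewrite inE => /allP hy.
(* The linear extension of the basis inclusion is the identity, which expands [y] over its
   support. *)
have -> : y = @dsv_ext K lam mu G dsv y.
  elim/dsv_ind: y {hy} => [|a g y IH].
    have := @dsv_ext_lin K lam mu G dsv (-1) 0 0.
    by rewrite scaler0 addr0 scaleN1r addNr.
  by rewrite dsv_ext_lin dsv_ext_basis -IH.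
rewrite /dsv_ext; elim: (finmap.enum_fset _) hy => [|g s IH] hs; first by rewrite big_nil.
rewrite big_cons; apply: TS; first by apply: hs; rewrite mem_head.
by apply: IH => h hh; apply: hs; rewrite inE hh orbT.
Qed.

Variables (Q : lieModType G) (A : Q -> Prop).

Lemma act_dsv_span (B : pred gen) (T : Q -> Prop) v : subspace T ->
  (forall g, B g -> T (lact (dsv g : G) v)) ->
  forall y : G, y \in dsv_span B -> T (lact y v).
Proof.
move=> sT Tg y; move: y; apply: dsv_span_ind => [|a g y Bg Ty].
  by rewrite lact0l; exact: subspace0.
by rewrite lact_linl; case: sT => _; apply=> //; exact: Tg.
Qed.

(** Passing a letter leaves a bracket in the same span. That bracket need not be a basis element, so
    the induction on words quantifies over all [y] in the span. *)
Lemma act_gspan (x : nat -> G) (B : pred gen) : subspace A ->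
  (forall g v, B g -> A v -> gspan x A (lact (dsv g : G) v)) ->
  (forall g j, B g -> lie (dsv g : G) (x j) \in dsv_span B) ->
  forall (y : G) w, y \in dsv_span B -> gspan x A w -> gspan x A (lact y w).
Proof.
move=> sA BA Bx y w yB hw; have sT := gspan_subspace x sA.
elim: hw y yB => {w} [v Av|a v w _ IHv _ IHw|j v hv IH] y yB.
- by apply: act_dsv_span yB => // g Bg; apply: BA.
- by rewrite lact_linr; apply: gspan_lin; [apply: IHv | apply: IHw].
- apply: act_dsv_span yB => // g Bg; rewrite lact_comm; apply: (subspaceD sT).
    by apply: gspan_act; apply: IH; apply: dsv_span_basis.
  by apply: IH; apply: Bx.
Qed.

End DSVSpan.

(** * The spaces K1, K2 and V, and descent through the three kinds of letters *)

Section Descent.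
Variables (K : numFieldType) (lam mu : K).
Local Notation G := (DSV lam mu).
Variables (d1 d2 t : nat).

Section Killed.
Variable P : lieModType G.

(** K1 is [killedM], K2 adds [killedY], and V is [killed]. *)
Definition killedM (v : P) : Prop :=
  forall i : int, t%:Z < i -> lact (dsv (gM i) : G) v = 0.
Definition killedY (v : P) : Prop :=
  forall j : int, (t + d2)%:Z < j -> lact (dsv (gY j) : G) v = 0.
Definition killedL (v : P) : Prop :=
  forall k : int, (t + d1)%:Z < k -> lact (dsv (gL k) : G) v = 0.
Definition killed (v : P) : Prop := [/\ killedM v, killedY v & killedL v].

Lemma killedM_subspace : subspace killedM.
Proof.
split=> [i _|a v w hv hw i ti]; first exact: lact0.
by rewrite lact_linr hv // hw // scaler0 addr0.
Qed.
Lemma killedMY_subspace : subspace (fun v => killedM v /\ killedY v).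
Proof.
split=> [|a v w [Mv Yv] [Mw Yw]]; split=> i ti; rewrite ?lact0 //.
  by rewrite lact_linr Mv // Mw // scaler0 addr0.
by rewrite lact_linr Yv // Yw // scaler0 addr0.
Qed.
Lemma killed_subspace : subspace killed.
Proof.
split=> [|a v w [Mv Yv Lv] [Mw Yw Lw]]; split=> i ti; rewrite ?lact0 //.
- by rewrite lact_linr Mv // Mw // scaler0 addr0.
- by rewrite lact_linr Yv // Yw // scaler0 addr0.
- by rewrite lact_linr Lv // Lw // scaler0 addr0.
Qed.

Lemma lact_dsv_comm g h (v : P) : lact (dsv g : G) (lact (dsv h : G) v) =
  lact (dsv h : G) (lact (dsv g : G) v) + lact (dsv_brk lam mu g h) v.
Proof. by rewrite lact_comm; congr (_ + lact _ v); exact: dsv_lieE. Qed.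

Lemma killedM_M n v : killedM v -> killedM (lact (dsv (gM n) : G) v).
Proof. by move=> hv i ti; rewrite lact_dsv_comm hv //= lact0 lact0l addr0. Qed.

Lemma killedM_Y n v : killedM v -> killedM (lact (dsv (gY n) : G) v).
Proof. by move=> hv i ti; rewrite lact_dsv_comm hv //= lact0 lact0l addr0. Qed.

Lemma killedM_L n v : 0 <= n -> killedM v -> killedM (lact (dsv (gL n) : G) v).
Proof.
move=> n0 hv i ti; rewrite lact_dsv_comm hv // lact0 add0r lactNl lactZl hv ?scaler0 ?oppr0 //.
by lia.
Qed.

Lemma killedMY_M n v : killedM v /\ killedY v ->
  killedM (lact (dsv (gM n) : G) v) /\ killedY (lact (dsv (gM n) : G) v).
Proof.
case=> Mv Yv; split; first exact: killedM_M.
by move=> j tj; rewrite lact_dsv_comm Yv //= lact0 lact0l addr0.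
Qed.

Hypothesis hd : (2 * d2 - 1 <= d1)%N.

Lemma killed_stable g v : sub_basis d1 d2 g -> killed v -> killed (lact (dsv g : G) v).
Proof.
case: g => [n|n|n|] /= gn [Mv Yv Lv].
- split; first exact: killedM_L.
    move=> j tj; rewrite lact_dsv_comm Yv //= lact0 add0r lactNl lactZl Yv ?scaler0 ?oppr0 //; lia.
  move=> k tk; rewrite lact_dsv_comm Lv //= lact0 add0r lact_linl lactZl Lv; last by lia.
  (* The indices add up to a positive number, so no central term appears. *)
  by case: eqP => [E|_]; [exfalso; lia | rewrite scale0r scaler0 addr0].
- have [? ?] := killedMY_M n (conj Mv Yv); split=> // k tk.
  by rewrite lact_dsv_comm Lv //= lact0 add0r lactZl Mv ?scaler0 //; lia.
- split; first exact: killedM_Y.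
    by move=> j tj; rewrite lact_dsv_comm Yv //= lact0 add0r lactZl Mv ?scaler0 //; lia.
  (* The new index is at least t + d1 + 2 - d2, which exceeds t + d2 because d1 >= 2 d2 - 1. *)
  by move=> k tk; rewrite lact_dsv_comm Lv //= lact0 add0r lactZl Yv ?scaler0 //; lia.
- by split=> i ti; rewrite lact_dsv_comm ?Mv ?Yv ?Lv //= lact0 lact0l addr0.
Qed.
End Killed.

(* The basis elements outside G^(d1,d2). *)
Definition xM (j : nat) : G := dsv (gM (- (d1 + j.+1)%:Z)).
Definition xY (j : nat) : G := dsv (gY (- (d2 + j)%:Z)).
Definition xL (j : nat) : G := dsv (gL (- (j.+1)%:Z)).

(** The letters L are outermost and the letters M innermost: each layer is then stable under the
    brackets produced by the letters around it. *)
Definition full_span (Q : lieModType G) (A : Q -> Prop) : Q -> Prop :=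
  gspan xL (gspan xY (gspan xM A)).

Section Spanning.
Variables (Q : lieModType G) (A : Q -> Prop).
Hypothesis sA : subspace A.
Hypothesis A_stable : forall g v, sub_basis d1 d2 g -> A v -> A (lact (dsv g : G) v).

(** [basis1] adjoins all M to G^(d1,d2), and [basis2] all M and Y; they preserve the inner and the
    middle layer of [full_span]. *)
Definition basis1 (g : gen) : bool :=
  match g with gL n => 0 <= n | gM _ => true | gY n => 1 - d2%:Z <= n | gC => true end.
Definition basis2 (g : gen) : bool :=
  match g with gL n => 0 <= n | _ => true end.

Lemma spanM_stable (y : G) w : y \in dsv_span basis1 -> gspan xM A w -> gspan xM A (lact y w).
Proof.
apply: act_gspan => // {y w} [g v|g j].
  case: g => [n|n|n|] gn Av; try by apply/gspan_base/A_stable.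
  have [nd|nd] := leP (- d1%:Z) n; first by apply/gspan_base/A_stable.
  have -> : dsv (gM n) = xM (absz (- d1%:Z - n - 1)%R).
    by congr (dsv (gM _)); lia.
  exact/gspan_act/gspan_base.
move=> gB; rewrite /xM [lie _ _]dsv_lieE; case: g gB => [n|n|n|] gB /=.
all: try exact: dsv_span0.
by apply: dsv_spanZ; apply: dsv_span_basis.
Qed.

Lemma spanY_stable (y : G) w : y \in dsv_span basis2 ->
  gspan xY (gspan xM A) w -> gspan xY (gspan xM A) (lact y w).
Proof.
apply: act_gspan => {y w} [|g v gB hv|g j gB]; first exact: gspan_subspace.
  case: g gB => [n|n|n|] gB; try by apply/gspan_base/spanM_stable => //; apply: dsv_span_basis.
  have [nd|nd] := leP (1 - d2%:Z) n.
    by apply/gspan_base/spanM_stable => //; apply: dsv_span_basis.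
  have -> : dsv (gY n) = xY (absz (- d2%:Z - n)%R).
    by congr (dsv (gY _)); lia.
  exact/gspan_act/gspan_base.
rewrite /xY [lie _ _]dsv_lieE; case: g gB => [n|n|n|] gB /=.
all: try exact: dsv_span0.
all: by apply: dsv_spanZ; apply: dsv_span_basis.
Qed.

Lemma full_span_stable (y : G) w : full_span A w -> full_span A (lact y w).
Proof.
have : y \in dsv_span predT by apply/dsv_spanP.
apply: act_gspan => {y w} [|g v _ hv|g j _]; last by apply/dsv_spanP.
  exact/gspan_subspace/gspan_subspace.
case: g => [n|n|n|]; try by apply/gspan_base/spanY_stable => //; apply: dsv_span_basis.
have [n0|n0] := leP 0 n.
  by apply/gspan_base/spanY_stable => //; apply: dsv_span_basis.
have -> : dsv (gL n) = xL (absz (- n - 1)%R) by congr (dsv (gL _)); lia.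
exact/gspan_act/gspan_base.
Qed.

Lemma full_span_submodule : lie_submodule (full_span A).
Proof.
split; [|by move=> *; apply: gspan_lin|exact: full_span_stable].
exact/gspan_base/gspan_base/gspan_base/(subspace0 sA).
Qed.
End Spanning.

(** * Removing the letters L, Y and M in turn *)

Section Descending.
Variables (Q P : lieModType G) (phi : Q -> P) (A : Q -> Prop).
Hypothesis phi_lin : forall (a : K) v w, phi (a *: v + w) = a *: phi v + phi w.
Hypothesis phi_act : forall (y : G) v, phi (lact y v) = lact y (phi v).
Hypothesis sA : subspace A.
Hypothesis A_stable : forall g v, sub_basis d1 d2 g -> A v -> A (lact (dsv g : G) v).
Hypothesis A_killed : forall v, A v -> killed (phi v).
Hypothesis phi_inj : forall v, A v -> phi v = 0 -> v = 0.
Hypothesis M_inj : forall v : P, killedM v -> lact (dsv (gM t%:Z) : G) v = 0 -> v = 0.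
Hypothesis hGamma : Gamma1 lam mu.

(** The two factors of Gamma_1 are the coefficients of M_t in [L_{-i}, M_{t+i}] and, up to sign, in
    [L_{t+i}, M_{-i}]. *)
Lemma Gamma1_l i : (0 < i)%N -> (lam + 1) * i%:R + t%:R + 2 * mu != 0.
Proof. by move=> i0; have /eqP := @hGamma t i i0; rewrite mulf_eq0 => /norP[]. Qed.
Lemma Gamma1_r i : (0 < i)%N -> i%:R + lam * (i%:R + t%:R) - 2 * mu != 0.
Proof. by move=> i0; have /eqP := @hGamma t i i0; rewrite mulf_eq0 => /norP[]. Qed.

(** The partner of [xM i] is L_{t+d1+i+1}; its bracket with [xM j] is a multiple of M_{t+i-j}, zero
    on [killedM] for j < i and nonzero for j = i by the second factor of Gamma_1. *)
Lemma spanM_descent w : gspan xM A w -> killed (phi w) -> A w.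
Proof.
apply: (@commuting_descent K G Q P phi phi_lin phi_act xM
  (fun i => dsv (gL (t + d1 + i.+1)%:Z)) (dsv (gM t%:Z))
  (fun i => - ((d1 + i.+1)%:R + lam * ((d1 + i.+1)%:R + t%:R) - 2 * mu))
  A (@killed P) (@killedM P)) => //.
- exact: killedM_subspace.
- by move=> i j; rewrite [LHS]dsv_lieE.
- by move=> j v; apply: killedM_M.
- by move=> v; apply: killedM_M.
- move=> i j v ji Cv; rewrite [lie _ _]dsv_lieE lactZl Cv ?scaler0 //; lia.
- move=> i v Cv; rewrite [lie _ _]dsv_lieE lactZl; congr (_ *: lact (dsv (gM _)) _).
    by rewrite -!pmulrn !natrD; ring.
  by lia.
- move=> i v Cv; rewrite [lie _ _]dsv_lieE lactZl Cv ?scaler0 //; lia.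
- by move=> j; rewrite [LHS]dsv_lieE.
- by move=> i; rewrite oppr_eq0 Gamma1_r // addnS.
- by move=> v [].
- by move=> i v [_ _ Lv]; apply: Lv; lia.
- exact: subspace0 (killed_subspace P).
Qed.

Lemma spanM_killed w : gspan xM A w -> killedM (phi w) /\ killedY (phi w).
Proof.
apply: (morph_gspan phi_lin phi_act (killedMY_subspace P)).
  by move=> v /A_killed[].
by move=> j v; apply: killedMY_M.
Qed.

(** Zero is killed, so descent puts the kernel inside [A]. This is the injectivity that the next
    layer takes as hypothesis. *)
Lemma spanM_inj w : gspan xM A w -> phi w = 0 -> w = 0.
Proof.
move=> hw w0; apply: phi_inj => //; apply: spanM_descent => //.
by rewrite w0; exact: subspace0 (killed_subspace P).
Qed.

(** The partner of [xY i] is [gY (t + d2 + i + 1)]; the coefficient of M_t in their bracket is a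
    positive integer, whatever lambda and mu are. *)
Lemma spanY_descent w : gspan xY (gspan xM A) w ->
  killedM (phi w) /\ killedY (phi w) -> gspan xM A w.
Proof.
apply: (@word_descent K G Q P phi phi_lin phi_act xY
  (fun i => dsv (gY (t + d2 + i.+1)%:Z)) (fun n => dsv (gM n)) t%:Z
  (fun i j => (t + d2 + i.+1 + d2 + j)%:R) (gspan xM A)
  (fun v => killedM v /\ killedY v)) => //.
- exact: gspan_subspace.
- by move=> n k; exists 0, 0; rewrite [LHS]dsv_lieE scale0r.
- move=> i j; exists 0, 0%N; do 2! eexists.
  by rewrite [LHS]dsv_lieE scale0r add0r.
- move=> i j; rewrite [LHS]dsv_lieE /=; congr (_ *: dsv (gM _)); last by lia.
  by rewrite pmulrn; congr (_%:~R); lia.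
- by move=> i; rewrite pnatr_eq0; lia.
- by move=> n v; apply: spanM_stable => //; apply: dsv_span_basis.
- by move=> n v; apply: killedMY_M.
- by move=> n v tn [Mv _]; apply: Mv.
- by move=> v [Mv _]; apply: M_inj.
- by move=> i v [_ Yv]; apply: Yv; lia.
- exact: spanM_killed.
- exact: spanM_inj.
Qed.

Lemma spanY_killed w : gspan xY (gspan xM A) w -> killedM (phi w).
Proof.
apply: (morph_gspan phi_lin phi_act (killedM_subspace P)).
  by move=> v /spanM_killed[].
by move=> j v; apply: killedM_Y.
Qed.

Lemma spanY_inj w : gspan xY (gspan xM A) w -> phi w = 0 -> w = 0.
Proof.
move=> hw w0; apply: spanM_inj => //; apply: spanY_descent => //.
by rewrite w0; exact: subspace0 (killedMY_subspace P).
Qed.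

(** The partner of [xL i] is M_{t+i+1}, and the first factor of Gamma_1 makes the diagonal
    coefficients nonzero. *)
Lemma spanL_descent w : full_span A w -> killedM (phi w) -> gspan xY (gspan xM A) w.
Proof.
apply: (@word_descent K G Q P phi phi_lin phi_act xL
  (fun i => dsv (gM (t + i.+1)%:Z)) (fun n => dsv (gM n)) t%:Z
  (fun i j => - ((t + i.+1)%:R + lam * (j.+1)%:R + 2 * mu)) (gspan xY (gspan xM A))
  (@killedM P)) => //.
- exact/gspan_subspace/gspan_subspace.
- move=> n k; do 2! eexists; by rewrite [LHS]dsv_lieE /= -scaleNr.
(* L_{-i-1} and L_{-j-1} bracket to a multiple of L_{-i-j-2}, that is [xL (i + j + 1)]; the index is
   negative, so there is no central term. *)
- move=> i j; exists (i%:R - j%:R), (i + j).+1%N, 0, 0.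
  have ij : (- (i.+1)%:Z - (j.+1)%:Z == 0) = false by apply/eqP; lia.
  rewrite [LHS]dsv_lieE scale0r addr0 /dsv_brk ij.
  rewrite scale0r addr0 /xL; congr (_ *: dsv (gL _)).
  by rewrite !pmulrn -intrB; congr (_%:~R); lia.
- move=> i j; rewrite [LHS]dsv_lieE /= -scaleNr; congr (_ *: dsv (gM _)); last by lia.
  by rewrite mulrNz -!pmulrn; ring.
- move=> i; rewrite oppr_eq0; have /= := @Gamma1_l i.+1 isT.
  by congr (_ != 0); rewrite natrD; ring.
- by move=> n v; apply: spanY_stable => //; apply: dsv_span_basis.
- by move=> n v; apply: killedM_M.
- by move=> n v tn; apply.
- by move=> i v Mv; apply: Mv; lia.
- exact: spanY_killed.
- exact: spanY_inj.
Qed.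

Lemma full_span_descent w : full_span A w -> killed (phi w) -> A w.
Proof.
move=> hw kw; have [Mw Yw _] := kw.
by apply: spanM_descent => //; apply: spanY_descent => //; apply: spanL_descent.
Qed.

Lemma full_span_inj w : full_span A w -> phi w = 0 -> w = 0.
Proof.
move=> hw w0; apply: phi_inj => //; apply: full_span_descent => //.
by rewrite w0; exact: subspace0 (killed_subspace P).
Qed.
End Descending.
End Descent.

(** * Modules over a subalgebra and induction *)

Record stableSub (K : fieldType) (L : lieAlgType K) (S : lieSub L)
    (P : lieModType L) := StableSub {
  stable_pred :> {pred P};
  stable_submod : submod_closed stable_pred;
  stable_act : forall y v, y \in S -> v \in stable_pred -> lact y v \in stable_pred
}.

Record stable_type (K : fieldType) (L : lieAlgType K) (S : lieSub L)
    (P : lieModType L) (N : stableSub S P) :=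
  StableType { stable_val : P; stable_valP : stable_val \in N }.

Section StableStructure.
Variables (K : fieldType) (L : lieAlgType K) (S : lieSub L) (P : lieModType L).
Variable N : stableSub S P.

HB.instance Definition _ :=
  GRing.isSubmodClosed.Build K P (stable_pred N) (stable_submod N).
HB.instance Definition _ := [isSub for @stable_val K L S P N].
HB.instance Definition _ := [Choice of stable_type N by <:].
HB.instance Definition _ := [SubChoice_isSubLmodule of stable_type N by <:].

Definition stable_lact (y : lsub_type S) (v : stable_type N) : stable_type N :=
  StableType (stable_act (lsub_valP y) (stable_valP v)).

Lemma stable_val_lin a (v w : stable_type N) :
  stable_val (a *: v + w) = a *: stable_val v + stable_val w.
Proof.
have -> : stable_val (a *: v + w) = stable_val (a *: v) + stable_val w.
  exact: (raddfD (val : stable_type N -> P)).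
by congr (_ + _); exact: (@GRing.valZ _ _ _ (stable_type N)).
Qed.
Lemma stable_val_inj : injective (@stable_val K L S P N).
Proof. exact: val_inj. Qed.
Lemma stable_val0 : stable_val (0 : stable_type N) = 0.
Proof. exact: (raddf0 (val : stable_type N -> P)). Qed.

Fact stable_linl (a : K) x y v :
  stable_lact (a *: x + y) v = a *: stable_lact x v + stable_lact y v.
Proof. by apply: stable_val_inj; rewrite stable_val_lin /= lact_linl. Qed.
Fact stable_linr (a : K) x v w :
  stable_lact x (a *: v + w) = a *: stable_lact x v + stable_lact x w.
Proof. by apply: stable_val_inj; rewrite stable_val_lin /= lact_linr. Qed.
Fact stable_lie x y v : stable_lact (lie x y) v =
  stable_lact x (stable_lact y v) - stable_lact y (stable_lact x v).
Proof.
apply: stable_val_inj; rewrite addrC -scaleN1r stable_val_lin scaleN1r addrC /=.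
exact: lact_lie.
Qed.
HB.instance Definition _ := isLieModule.Build K (lsub_type S) (stable_type N)
  stable_linl stable_linr stable_lie.
End StableStructure.

(** * The universal property of the induced module *)

Section FrobeniusReciprocity.
Variables (K : fieldType) (L : lieAlgType K) (S : lieSub L).
Variables (V : lieModType (lsub_type S)) (P : lieModType L) (f : V -> P).
Hypothesis f_lin : forall (a : K) v w, f (a *: v + w) = a *: f v + f w.
Hypothesis f_act : forall y v, f (lact y v) = lact (lsub_val y) (f v).

Let f0 : f 0 = 0.
Proof. by have := f_lin (-1) 0 0; rewrite scaler0 addr0 scaleN1r addNr. Qed.
Let fD v w : f (v + w) = f v + f w.
Proof. by have := f_lin 1 v w; rewrite !scale1r. Qed.
Let fZ a v : f (a *: v) = a *: f v.
Proof. by have := f_lin a v 0; rewrite f0 !addr0. Qed.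

Lemma f_ueval s v : f (ueval s v) = ueval (uterm_incl s) (f v).
Proof.
elim: s v => [y|a|s IHs s' IHs'|s IHs s' IHs'] v /=.
- exact: f_act.
- exact: fZ.
- by rewrite fD IHs IHs'.
- by rewrite IHs IHs'.
Qed.

Lemma f_uact (b : uenv (lsub_type S)) (v : umod V) :
  f (uact b v) = uact (uincl b) (f v : umod P).
Proof. by elim/uenv_ind: b => s; rewrite uinclE !uactE f_ueval. Qed.

Fixpoint teval (s : tterm (uenv L) (umod V)) : umod P :=
  match s with
  | TZero => 0
  | TTens a v => uact a (f v)
  | TAdd s t => teval s + teval t
  | TOpp s => - teval s
  end.

(** Makes a (x) v -> a f(v) well defined; the balancing relation is respected because [f]
    intertwines the actions of U(S) and U(L). *)
Lemma teval_eq s t : teq (@uincl K L S) s t -> teval s = teval t.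
Proof.
elim=> //= {s t}.
- by move=> t s u _ -> _.
- by move=> s s' t t' _ -> _ ->.
- by move=> s s' _ ->.
- by move=> *; rewrite addrA.
- by move=> *; rewrite addrC.
- by move=> *; rewrite add0r.
- by move=> *; rewrite addNr.
- by move=> *; exact: uactDl.
- by move=> a v v'; rewrite fD; exact: uactDr.
- by move=> a b v; rewrite -uactA -f_uact.
Qed.

Definition ind_map (w : Ind V) : P := teval (trepr w).

Lemma ind_mapE s : ind_map (tpi (@uincl K L S) s) = teval s.
Proof. exact/teval_eq/trepr_pi. Qed.

Lemma ind_map_tens a (v : V) :
  ind_map (tens (@uincl K L S) a (v : umod V)) = uact a (f v : umod P).
Proof. exact: ind_mapE. Qed.

Lemma ind_mapD v w : ind_map (v + w) = ind_map v + ind_map w.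
Proof.
by elim/extscal_ind: v => s; elim/extscal_ind: w => t; rewrite -tpiD !ind_mapE.
Qed.

Lemma ind_map_uscale (a : uenv L) (w : extscal (@uincl K L S) (umod V)) :
  ind_map (a *: w) = uact a (ind_map w : umod P).
Proof.
elim/extscal_ind: w => s; rewrite [_ *: _]tscaleE !ind_mapE.
elim: s => [|b v|s IHs t IHt|s IHs] /=.
- by rewrite -[RHS]/(a *: (0 : umod P)) scaler0.
- by rewrite uactA.
- by rewrite IHs IHt -uactDr.
- by rewrite IHs -[RHS]/(a *: (- teval s : umod P)) scalerN.
Qed.

Lemma ind_map_lin (a : K) v w : ind_map (a *: v + w) = a *: ind_map v + ind_map w.
Proof.
rewrite ind_mapD; congr (_ + _).
rewrite [LHS]ind_map_uscale -[a *: 1]/(uscal L a * 1) mulr1; exact: uactE.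
Qed.

Lemma ind_map_act (y : L) w : ind_map (lact y w) = lact y (ind_map w).
Proof. rewrite [LHS]ind_map_uscale; exact: uactE. Qed.
End FrobeniusReciprocity.

Section InducedGenerators.
Variables (K : fieldType) (L : lieAlgType K) (S : lieSub L).
Variable V : lieModType (lsub_type S).

Definition ind_base (v : V) : Ind V := tens (@uincl K L S) 1 (v : umod V).

Lemma ind_base_lin a v w : ind_base (a *: v + w) = a *: ind_base v + ind_base w.
Proof.
rewrite [LHS]tensDr; congr (_ + _); rewrite [RHS]scale_tens mulr1.
have -> : a *: 1 = 1 * uincl (uscal (lsub_type S) a) :> uenv L.
  by rewrite mul1r uinclE /=; exact: mulr1.
by rewrite tens_bal; congr (tens _ _ _); rewrite [RHS]uactE.
Qed.

Lemma ind_base_act y v : ind_base (lact y v) = lact (lsub_val y) (ind_base v).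
Proof.
rewrite [RHS]scale_tens mulr1.
have -> : uiota (lsub_val y) = 1 * uincl (uiota y) :> uenv L.
  by rewrite mul1r uinclE.
by rewrite tens_bal; congr (tens _ _ _); rewrite [RHS]uactE.
Qed.

(** Every a (x) v is a (1 (x) v), and [a] is an expression in scalars and elements of L, under which
    a submodule is stable. *)
Lemma ind_generated (N : Ind V -> Prop) : lie_submodule N ->
  (forall v, N (ind_base v)) -> forall w, N w.
Proof.
case=> N0 Nlin Nact Nb.
have ND v w : N v -> N w -> N (v + w) by move=> Nv Nw; rewrite -[v]scale1r; apply: Nlin.
have NZ (a : K) v : N v -> N (a *: v) by move=> Nv; rewrite -[_ *: _]addr0; apply: Nlin.
have Nu (s : uterm L) (w : extscal (@uincl K L S) (umod V)) : N w -> N (upi s *: w).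
  elim: s w => [y|a|s IHs t IHt|s IHs t IHt] w Nw.
  - exact: (Nact y w Nw).
  - have <- : a *: 1 = upi (UScal a) :> uenv L by exact: mulr1.
    exact: NZ.
  - have -> : upi (UAdd s t) = upi s + upi t by rewrite [RHS]uaddE.
    by rewrite scalerDl; apply: ND; [apply: IHs|apply: IHt].
  - have -> : upi (UMul s t) = upi s * upi t by rewrite [RHS]umulE.
    by rewrite -scalerA; apply: IHs; apply: IHt.
elim/extscal_ind; elim=> [|a v|s IHs t IHt|s IHs].
- exact: N0.
- elim/uenv_ind: a => a; have := Nu a _ (Nb v).
  by rewrite scale_tens mulr1.
- by rewrite tpiD; apply: ND.
- by rewrite tpiN; have := NZ (-1) _ IHs; rewrite scaleN1r.
Qed.
End InducedGenerators.

(** * The module V and the theorem *)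

Section MainProof.
Variables (K : numFieldType) (lam mu : K).
Local Notation G := (DSV lam mu).
Variable P : lieModType G.

(** Above degree n, the degrees n + k/2 with k even carry L and M, those with k odd carry Y. *)
Lemma restricted_killed (v : P) : restricted P -> exists n : nat,
  [/\ killedM n v, killedY 0 n v & killedL 0 n v].
Proof.
move=> hres; have [n hn] := hres v; exists n.
have h g (k : nat) : (0 < k)%N -> gdeg g = n%:R + k%:R / 2 -> lact (dsv g : G) v = 0.
  by move=> k0 gk; apply: (hn k) => //; apply: dsv_span_basis; rewrite /= gk.
have above (i : int) : n%:Z < i -> exists m : nat, i = (n + m.+1)%:Z.
  by move=> ni; exists (absz (i - n%:Z - 1)%R); lia.
have degM m : (n + m.+1)%:Q = n%:R + (2 * m.+1)%:R / 2.
  by rewrite -!pmulrn natrD natrM; field.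
split=> i ni.
- by have [m ->] := above i ni; apply: (h _ (2 * m.+1)%N) => //; apply: degM.
- have [|m ->] := above i; first by lia.
  by apply: (h _ m.*2.+1%N) => //=; rewrite degM -addn1 -mul2n natrD !natrM; field.
- have [|m ->] := above i; first by lia.
  by apply: (h _ (2 * m.+1)%N) => //; apply: degM.
Qed.

Lemma exists_depth (a : nat) : restricted P -> (exists v : P, v <> 0) ->
  injective (lact (dsv (gM a%:Z) : G) : P -> P) ->
  exists t : nat, (exists2 v : P, v <> 0 & killedM t v) /\
    forall v : P, killedM t v -> lact (dsv (gM t%:Z) : G) v = 0 -> v = 0.
Proof.
move=> hres [v v0] ainj.
have : exists t : nat, `[< exists2 v : P, v <> 0 & killedM t v >].
  by have [t [? _ _]] := restricted_killed v hres; exists t; apply/asboolP; exists v.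
move/ex_minnP=> [t /asboolP ht tmin]; exists t; split=> // w kw Mw.
apply: contrapT => w0.
have kw' (i : int) : t%:Z <= i -> lact (dsv (gM i) : G) w = 0.
  by rewrite le_eqVlt => /orP[/eqP <- //|/kw].
have [ta|at'] := leqP t a.
  by apply: w0; apply: ainj; rewrite lact0 kw' //; lia.
(* Here t > a, so t is positive and [w] contradicts its minimality. *)
have : (t <= t.-1)%N; last by lia.
by apply: tmin; apply/asboolP; exists w => // i ti; apply: kw'; lia.
Qed.

Variables (d1 d2 t : nat) (hd : (2 * d2 - 1 <= d1)%N).
Local Notation S := (dsv_sub lam mu hd).

Fact killed_submod : submod_closed [pred v : P | `[< killed d1 d2 t v >]].
Proof.
have [k0 klin] := killed_subspace d1 d2 t P.
split=> [|a v w /asboolP kv /asboolP kw]; first by apply/asboolP; exact: k0.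
by apply/asboolP; exact: klin.
Qed.

Fact killed_act (y : G) (v : P) : y \in S ->
  v \in [pred v : P | `[< killed d1 d2 t v >]] ->
  lact y v \in [pred v : P | `[< killed d1 d2 t v >]].
Proof.
move=> yS /asboolP kv; apply/asboolP.
apply: act_dsv_span yS; first exact: killed_subspace.
by move=> g gS; apply: killed_stable.
Qed.

Definition killed_sub : stableSub S P := StableSub killed_submod killed_act.
Local Notation V := (stable_type killed_sub).

Lemma stable_val_killed (v : V) : killed d1 d2 t (stable_val v).
Proof. by have /asboolP := stable_valP v. Qed.

Hypothesis hsimple : lie_simple P.
Hypothesis hGamma : Gamma1 lam mu.
Hypothesis M_inj : forall v : P, killedM t v -> lact (dsv (gM t%:Z) : G) v = 0 -> v = 0.
Hypothesis V_neq0 : exists2 v : P, v <> 0 & killed d1 d2 t v.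

Lemma sub_elt g : sub_basis d1 d2 g -> dsv g \in S.
Proof. exact: dsv_span_basis. Qed.

Lemma killed_simple : lie_simple V.
Proof.
split.
  have [v v0 kv] := V_neq0.
  have vV : v \in killed_sub by apply/asboolP.
  by exists (StableType vV) => /(congr1 (@stable_val _ _ _ _ _)).
move=> N [N0 Nlin Nact].
pose A (v : P) := exists2 u : V, N u & v = stable_val u.
have sA : subspace A.
  split; first by exists 0 => //; rewrite stable_val0.
  move=> a _ _ [u Nu ->] [u' Nu' ->].
  by exists (a *: u + u'); [exact: Nlin | rewrite stable_val_lin].
have A_stable g v : sub_basis d1 d2 g -> A v -> A (lact (dsv g : G) v).
  move=> gS [u Nu ->]; exists (lact (LsubType (sub_elt gS) : lsub_type S) u) => //.
  exact: Nact.
have A_killed v : A v -> killed d1 d2 t v.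
  by move=> [u _ ->]; apply: stable_val_killed.
have [_ /(_ _ (full_span_submodule sA A_stable))[F0|FT]] := hsimple.
  left=> u Nu; apply: stable_val_inj; rewrite stable_val0; apply: F0.
  (* An element of [A] is an empty word in each of the three layers. *)
  by do 3! apply: gspan_base; exists u.
right=> u; have : A (stable_val u).
  by apply: (full_span_descent (phi := id)) (FT _) (stable_val_killed u).
by case=> u' Nu' /stable_val_inj ->.
Qed.

Lemma killed_ind_iso : lie_iso P (Ind V).
Proof.
pose f : V -> P := @stable_val _ _ _ _ _.
have f_lin (a : K) v w : f (a *: v + w) = a *: f v + f w by exact: stable_val_lin.
have f_act y v : f (lact y v) = lact (lsub_val y) (f v) by [].
pose phi := ind_map f.
have phi_lin := ind_map_lin f_lin f_act; rewrite -/phi in phi_lin.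
have phi_act := ind_map_act f_lin f_act; rewrite -/phi in phi_act.
have phi_base v : phi (ind_base v) = f v.
  by rewrite /phi ind_map_tens // -[RHS]scale1r; exact: uactE.
pose A (w : Ind V) := exists v : V, w = ind_base v.
have base0 : ind_base (0 : V) = 0.
  by have := ind_base_lin (-1) (0 : V) 0; rewrite scaler0 addr0 scaleN1r addNr.
have sA : subspace A.
  split; first by exists 0.
  by move=> a _ _ [v ->] [w ->]; exists (a *: v + w); rewrite ind_base_lin.
have A_stable g v : sub_basis d1 d2 g -> A v -> A (lact (dsv g : G) v).
  move=> gS [u ->]; exists (lact (LsubType (sub_elt gS) : lsub_type S) u).
  by rewrite ind_base_act.
have A_killed w : A w -> killed d1 d2 t (phi w).
  by move=> [u ->]; rewrite phi_base; apply: stable_val_killed.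
have A_inj w : A w -> phi w = 0 -> w = 0.
  move=> [u ->]; rewrite phi_base => fu0; rewrite -base0; congr (ind_base _).
  by apply: stable_val_inj; rewrite stable_val0.
(* Ind(V) is all of [full_span A], since that is a submodule containing the generators. *)
have phi_inj0 w : phi w = 0 -> w = 0.
  apply: (full_span_inj phi_lin phi_act sA A_stable A_killed A_inj M_inj hGamma).
  apply: (ind_generated (full_span_submodule sA A_stable)) => v.
  by do 3! apply: gspan_base; exists v.
have phi_inj : injective phi.
  move=> v w vw; apply/eqP; rewrite -subr_eq0; apply/eqP/phi_inj0.
  by rewrite (morphB phi_lin) vw subrr.
(* The image is a submodule of the simple module P, and it contains the nonzero space V. *)
have [im0|phi_surj] : (forall v, (exists w, phi w = v) -> v = 0) \/
    (forall v, exists w, phi w = v).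
- case: hsimple => _; apply; split; first by exists 0; exact: morph0 phi_lin.
    by move=> a _ _ [v <-] [w <-]; exists (a *: v + w); exact: phi_lin.
  by move=> y _ [v <-]; exists (lact y v); exact: phi_act.
- have [v v0 kv] := V_neq0; have vV : v \in killed_sub by apply/asboolP.
  by case: v0; apply: im0; exists (ind_base (StableType vV : V)); rewrite phi_base.
pose psi v := projT1 (cid (phi_surj v)).
have psiK : cancel psi phi by move=> v; exact: projT2 (cid (phi_surj v)).
have phiK : cancel phi psi by move=> w; apply: phi_inj; rewrite psiK.
exists psi; split; first by exists phi.
- by move=> a v w; apply: phi_inj; rewrite phi_lin !psiK.
- by move=> y v; apply: phi_inj; rewrite phi_act !psiK.
Qed.

Lemma killed_acts_injectively : acts_injectively V (dsv (gM t%:Z)).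
Proof.
have tS : dsv (gM t%:Z) \in S by apply: sub_elt => /=; lia.
exists (LsubType tS) => // v w /(congr1 (@stable_val _ _ _ _ _)) /= vw.
apply: stable_val_inj; apply/eqP; rewrite -subr_eq0; apply/eqP/M_inj.
  have [Mv _ _] := stable_val_killed v; have [Mw _ _] := stable_val_killed w.
  apply: (subspaceB (killedM_subspace _ _)); [exact: Mv|exact: Mw].
by rewrite lactB vw subrr.
Qed.

Lemma killed_acts_by_zero g : sub_basis d1 d2 g ->
  (forall v : P, killed d1 d2 t v -> lact (dsv g : G) v = 0) ->
  acts_by_zero V (dsv g).
Proof.
move=> gS g0; exists (LsubType (sub_elt gS)) => // v.
by apply: stable_val_inj; rewrite stable_val0 /= g0 //; apply: stable_val_killed.
Qed.
End MainProof.

Theorem theorem3p8 (R : realType) (lam mu : complex R)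
    (hGamma : Gamma1 lam mu)
    (P : lieModType (DSV lam mu)) (c : complex R)
    (hC : forall v : P, lact (dsv gC : DSV lam mu) v = c *: v)
    (hsimple : lie_simple P) (hres : restricted P)
    (hinj : exists2 a : nat, (0 < a)%N &
       injective (lact (dsv (gM a%:Z) : DSV lam mu) : P -> P)) :
  exists (d1 d2 : nat) (hd : (2 * d2 - 1 <= d1)%N)
         (V : lieModType (lsub_type (dsv_sub lam mu hd))),
    [/\ lie_simple V,
        acts_by_scalar V (dsv gC) c,
        (exists t : nat,
          [/\ acts_injectively V (dsv (gM t%:Z)),
              [/\ forall i : int, t%:Z < i -> acts_by_zero V (dsv (gM i)),
                  forall j : int, (t + d2)%:Z < j -> acts_by_zero V (dsv (gY j))
                & forall k : int, (t + d1)%:Z < k -> acts_by_zero V (dsv (gL k))]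
            & forall i : nat, (0 < i)%N ->
                ((lam + 1) * i%:R + t%:R + 2 * mu) *
                (i%:R + d1%:R + lam * (i%:R + t%:R + d1%:R) - 2 * mu) <> 0])
      & lie_iso P (Ind V)].
Proof.
have [a _ ainj] := hinj.
have [t [[v v0 Mv] M_inj]] := exists_depth hres (proj1 hsimple) ainj.
have [n [_ Yv Lv]] := restricted_killed v hres.
(* With d2 = n and d1 = 2n, the bounds t + d2 and t + d1 are at least n, so [v] lies in V. *)
have hd : (2 * n - 1 <= 2 * n)%N by lia.
have V_neq0 : exists2 v : P, v <> 0 & killed (2 * n) n t v.
  exists v => //; split=> // i ti; [apply: Yv | apply: Lv]; lia.
exists (2 * n)%N, n, hd, (stable_type (killed_sub P t hd)); split.
- exact: killed_simple.
- exists (LsubType (sub_elt _ _ hd (isT : sub_basis (2 * n) n gC))) => // w.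
  apply: stable_val_inj; rewrite /= hC -[RHS]addr0 -(stable_val0 (killed_sub P t hd)).
  by rewrite -stable_val_lin addr0.
- exists t; split; first exact: killed_acts_injectively.
    split=> i ti; apply: killed_acts_by_zero => [/=|w [Mw Yw Lw]]; try lia.
    + exact: Mw.
    + exact: Yw.
    + exact: Lw.
  (* Condition (c) combines the first factor of Gamma_1 at i with the second at i + d1. *)
  move=> i i0; have /eqP := hGamma t i i0; rewrite mulf_eq0 => /norP[hl _].
  have /eqP := hGamma t (i + 2 * n)%N (ltn_addr _ i0).
  rewrite mulf_eq0 => /norP[_ hr]; apply/eqP; rewrite mulf_neq0 //.
  by move: hr; congr (_ != 0); rewrite natrD; ring.
- exact: killed_ind_iso.
Qed.
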